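(* As identities of formal power series in $q$ (equivalently, of holomorphic functions of $q$ with $|q|<1$), \[ (q;q)_\infty^{-2} \left(q^2;q^2\right)_\infty^{-2}\sum_{\substack{ n_1 \geq 0 \\ n_2 \in \mathbb{Z}}} {\rm sgn}^*(n_2)(-1)^{n_1} q^{\frac{n_1(n_1+1)}{2}+n_1n_2+2n_2^2+2n_2 } = \sum_{\substack{n_1,n_2,n_3\in \mathbb{N}_0\\ n_4\in\mathbb{Z}}} \frac{q^{2n_1+2n_2+2n_3+ 3 |n_4| }}{(q^2;q^2)_{n_1} (q^2;q^2)_{n_1+|n_4|}(q^2;q^2)_{n_2} (q^2;q^2)_{n_2+ |n_4|} (q^2;q^2)_{n_3} (q^2;q^2)_{n_3+ |n_4|}}. \]
   Context: For $n\in\mathbb{N}_0\cup\{\infty\}$, $(a;q)_n:=\prod_{j=0}^{n-1}(1-aq^j)$. ${\rm sgn}^*(n):=1$ if $n\ge 0$ and ${\rm sgn}^*(n):=-1$ if $n<0$. $\mathbb{N}_0=\{0,1,2,\dots\}$. *)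

(* Defs.v *)
From Stdlib Require Import Reals ZArith.
From Coquelicot Require Export Coquelicot.
Open Scope C_scope.

Fixpoint Cpown (x : C) (n : nat) : C :=
  match n with O => 1 | S m => x * Cpown x m end.

Definition Cpowz (x : C) (z : Z) : C :=
  if (0 <=? z)%Z then Cpown x (Z.to_nat z) else Cinv (Cpown x (Z.to_nat (- z))).

Fixpoint qpoch (a q : C) (n : nat) : C :=
  match n with O => 1 | S m => qpoch a q m * (1 - a * Cpown q m) end.

Definition is_qpoch_inf (a q : C) (P : C) : Prop :=
  filterlim (qpoch a q) eventually (locally (P : C_NormedModule)).

Definition sgnstar (n : Z) : C := if (0 <=? n)%Z then 1 else -1.

Definition is_Cseries (f : nat -> C) (l : C) : Prop :=
  @is_series C_AbsRing C_NormedModule f l.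

Definition is_Zseries (f : Z -> C) (l : C) : Prop :=
  exists l1 l2 : C,
    is_Cseries (fun n => f (Z.of_nat n)) l1 /\
    is_Cseries (fun n => f (- Z.of_nat (S n))%Z) l2 /\
    l = l1 + l2.

Definition lhs_term (q : C) (n1 : nat) (n2 : Z) : C :=
  sgnstar n2 * Cpown (-1) n1 *
  Cpowz q ((Z.of_nat n1 * (Z.of_nat n1 + 1)) / 2 + Z.of_nat n1 * n2
           + 2 * n2 * n2 + 2 * n2)%Z.

Definition rhs_term (q : C) (n1 n2 n3 : nat) (n4 : Z) : C :=
  let m := Z.abs_nat n4 in
  let q2 := q * q in
  Cpown q (2 * n1 + 2 * n2 + 2 * n3 + 3 * m)%nat /
  (qpoch q2 q2 n1 * qpoch q2 q2 (n1 + m) * qpoch q2 q2 n2 * qpoch q2 q2 (n2 + m)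
   * qpoch q2 q2 n3 * qpoch q2 q2 (n3 + m)).

Definition is_lhs_sum (q : C) (L : C) : Prop :=
  exists g : nat -> C,
    (forall n1, is_Zseries (lhs_term q n1) (g n1)) /\ is_Cseries g L.

Definition is_rhs_sum (q : C) (R : C) : Prop :=
  exists (g3 : nat -> nat -> nat -> C) (g2 : nat -> nat -> C) (g1 : nat -> C),
    (forall n1 n2 n3, is_Zseries (rhs_term q n1 n2 n3) (g3 n1 n2 n3)) /\
    (forall n1 n2, is_Cseries (g3 n1 n2) (g2 n1 n2)) /\
    (forall n1, is_Cseries (g2 n1) (g1 n1)) /\
    is_Cseries g1 R.

(* Main.v *)
(* Write [1/((z;q)_oo (q/z;q)_oo) = sum_j B_j(q) z^j] on [|q| < |z| < 1]. Telescoping gives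
   [B_j + B_(-1-j) = (q;q)_oo^-2], and [B_(-j) = q^j B_j]; iterating these two relations,
   [B_j = (q;q)_oo^-2 sum_(n>=0) (-1)^n q^(n(n+1)/2 + nj)].
   With [a_m = q^|m| B_|m|(q^2)], the right-hand side of the theorem is [sum_m a_m^3].
   The relations for [B] also imply
     [a_m^2 = (q^2;q^2)_oo^-2 sum_k sgn*(k) q^(2k^2+2k) B_(k-m)(q^2)],
   because both sides satisfy the same first-order recurrence in [m], which has only one bounded
   solution. In the same way [sum_m a_m B_(k-m)(q^2) = B_k(q)], the coefficient form of
   [(zq;q^2)_oo (z;q^2)_oo = (z;q)_oo]. Summing over [m] first leaves
   [(q^2;q^2)_oo^-2 sum_k sgn*(k) q^(2k^2+2k) B_k(q)], which is the left-hand side. *)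
From Stdlib Require Import Reals ZArith Lra Lia List Classical ClassicalEpsilon.
From Stdlib Require Import FinFun FunctionalExtensionality.
Require Import Defs.
From Coquelicot Require Import Coquelicot.
Open Scope C_scope.

(** No function of z is manipulated: only the coefficients B_j occur, as absolutely convergent
    series, and the identities between them come from the complement and reflection relations.
    Combined, these express a term through its successor, and the difference x of two solutions
    satisfies |x_n| <= |q| |x_(n+1)|, which for bounded x forces x = 0. The convolution identity
    needs one further input, the constant sum_m a_m, which is a product of two Euler series at z =
    1. Two facts shape the form of the statements. The theorem speaks of iterated series in
    prescribed orders, whereas the argument reorders them; hence sums over arbitrary index types
    along finite subsets, with one Fubini theorem. And q = 0 is allowed, so negative powers of q are
    avoided by multiplying relations by a high enough power of q; in the last step the theta weight
    q^(2k^2+2k) supplies that power. *)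

(** * Limits of complex-valued functions along a filter *)

Definition clim {T : Type} (F : (T -> Prop) -> Prop) (f : T -> C) (l : C) : Prop :=
  filterlim f F (locally (l : C_NormedModule)).

Lemma clim_eps {T} F {FF : Filter F} (f : T -> C) (l : C) :
  clim F f l <-> forall e : R, (0 < e)%R -> F (fun x => (Cmod (f x - l) < e)%R).
Proof.
  unfold clim. rewrite (@filterlim_locally_ball_norm C_AbsRing T C_NormedModule F FF).
  split.
  - intros H e He. exact (H (mkposreal e He)).
  - intros H [e He]. exact (H e He).
Qed.

Lemma clim_ext {T} F {FF : Filter F} (f g : T -> C) (l : C) :
  (forall x, f x = g x) -> clim F f l -> clim F g l.
Proof. intros H. apply filterlim_ext. exact H. Qed.

Lemma clim_unique {T} F {FF : ProperFilter F} (f : T -> C) (l k : C) :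
  clim F f l -> clim F f k -> l = k.
Proof. apply (@filterlim_locally_unique T C_AbsRing C_NormedModule F). typeclasses eauto. Qed.

Lemma clim_const {T} F {FF : Filter F} (c : C) : clim F (fun _ : T => c) c.
Proof.
  apply clim_eps; [exact FF|]. intros e He. apply filter_forall. intros _.
  replace (c - c) with (0 : C) by ring. now rewrite Cmod_0.
Qed.

Lemma clim_plus {T} F {FF : Filter F} (f g : T -> C) (l k : C) :
  clim F f l -> clim F g k -> clim F (fun x => f x + g x) (l + k).
Proof.
  rewrite !clim_eps by exact FF. intros Hf Hg e He.
  assert (He2 : (0 < e / 2)%R) by lra.
  generalize (filter_and _ _ (Hf _ He2) (Hg _ He2)).
  apply filter_imp. intros x [H1 H2].
  replace (f x + g x - (l + k)) with ((f x - l) + (g x - k)) by ring.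
  eapply Rle_lt_trans; [apply Cmod_triangle|lra].
Qed.

Lemma clim_mult {T} F {FF : Filter F} (f g : T -> C) (l k : C) :
  clim F f l -> clim F g k -> clim F (fun x => f x * g x) (l * k).
Proof.
  rewrite !clim_eps by exact FF. intros Hf Hg e He.
  set (M := (1 + Cmod l + Cmod k)%R).
  assert (HM : (1 <= M)%R) by (generalize (Cmod_ge_0 l), (Cmod_ge_0 k); unfold M; lra).
  set (d := Rmin 1%R (e / M)%R).
  assert (Hd : (0 < d)%R).
  { apply Rmin_glb_lt; [lra|]. apply Rdiv_lt_0_compat; lra. }
  generalize (filter_and _ _ (Hf d Hd) (Hg d Hd)).
  apply filter_imp. intros x [H1 H2].
  replace (f x * g x - l * k) with ((f x - l) * (g x - k) + (l * (g x - k) + (f x - l) * k)) by ring.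
  eapply Rle_lt_trans; [apply Cmod_triangle|].
  eapply Rle_lt_trans; [apply Rplus_le_compat_l, Cmod_triangle|].
  rewrite !Cmod_mult.
  assert (d <= 1)%R by apply Rmin_l.
  assert (d * M <= e)%R.
  { apply Rle_trans with (e / M * M)%R; [apply Rmult_le_compat_r; [lra|apply Rmin_r]|].
    right; field; lra. }
  generalize (Cmod_ge_0 (f x - l)), (Cmod_ge_0 (g x - k)), (Cmod_ge_0 l), (Cmod_ge_0 k).
  unfold M in *. nra.
Qed.

Lemma clim_inv {T} F {FF : Filter F} (f : T -> C) (l : C) :
  l <> 0 -> clim F f l -> clim F (fun x => / f x) (/ l).
Proof.
  rewrite !clim_eps by exact FF. intros Hl Hf e He.
  assert (HL : (0 < Cmod l)%R) by now apply Cmod_gt_0.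
  set (L := Cmod l) in *.
  set (d := Rmin (L / 2)%R (e * (L * L) / 2)%R).
  assert (HLL : (0 < e * (L * L))%R) by (apply Rmult_lt_0_compat; [exact He|]; nra).
  assert (Hd : (0 < d)%R) by (apply Rmin_glb_lt; lra).
  generalize (Hf d Hd). apply filter_imp. intros x Hx.
  assert (H1 : (d <= L / 2)%R) by apply Rmin_l.
  assert (H2 : (d <= e * (L * L) / 2)%R) by apply Rmin_r.
  assert (H3 : (L / 2 < Cmod (f x))%R).
  { assert (L <= Cmod (f x) + Cmod (f x - l))%R; [|lra].
    unfold L. replace l with (f x + - (f x - l)) at 1 by ring.
    rewrite <- (Cmod_opp (f x - l)). apply Cmod_triangle. }
  assert (Hfx : f x <> 0) by (apply Cmod_gt_0; lra).
  replace (/ f x - / l) with (- (f x - l) * / (f x * l)) by (field; auto).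
  rewrite Cmod_mult, Cmod_opp, Cmod_inv, Cmod_mult by (apply Cmult_neq_0; auto).
  fold L.
  apply Rmult_lt_reg_r with (Cmod (f x) * L)%R; [nra|].
  rewrite Rmult_assoc, Rinv_l, Rmult_1_r by nra.
  assert (e * (L * L) / 2 < e * (Cmod (f x) * L))%R; [|lra].
  assert (0 < (Cmod (f x) - L / 2) * (e * L))%R by (apply Rmult_lt_0_compat; nra). nra.
Qed.

(** * Unconditional sums *)

(** Duplicate-free lists stand for finite subsets of [I]; this is the filter of the directed set of
    finite subsets, so convergence along it does not depend on any ordering of [I]. *)
Definition finlists (I : Type) (P : list I -> Prop) : Prop :=
  exists l0, forall l, NoDup l -> incl l0 l -> P l.

Lemma NoDup_cover {I : Type} (l : list I) :
  exists l', NoDup l' /\ incl l l' /\ incl l' l.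
Proof.
  assert (dec : forall x y : I, {x = y} + {x <> y})
    by (intros x y; apply excluded_middle_informative).
  exists (nodup dec l). split; [apply NoDup_nodup|].
  split; intros x; apply nodup_In.
Qed.

#[global] Instance finlists_proper (I : Type) : ProperFilter (finlists I).
Proof.
  split.
  - intros P [l0 H]. destruct (NoDup_cover l0) as (l & Hl & Hi & _).
    exists l. auto.
  - split.
    + exists nil. auto.
    + intros P Q [l0 H0] [l1 H1]. exists (l0 ++ l1). intros l Hn Hi.
      split; [apply H0|apply H1]; auto; intros x Hx; apply Hi, in_or_app; auto.
    + intros P Q HPQ [l0 H]. exists l0. auto.
Qed.

Definition lsum {I : Type} (f : I -> C) (l : list I) : C :=
  fold_right (fun i s => f i + s) 0 l.

Definition lnorm {I : Type} (f : I -> C) (l : list I) : R :=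
  fold_right (fun i s => (Cmod (f i) + s)%R) 0%R l.

Definition has_sum {I : Type} (f : I -> C) (s : C) : Prop := clim (finlists I) (lsum f) s.

(** Absolute convergence, stated as a bound on finite sums of moduli: comparison, injections and
    products then need no limits. *)
Definition summable {I : Type} (f : I -> C) : Prop :=
  exists M : R, forall l, NoDup l -> (lnorm f l <= M)%R.

Lemma lsum_app {I} (f : I -> C) l l' : lsum f (l ++ l') = lsum f l + lsum f l'.
Proof. induction l as [|i l IH]; simpl; [ring|rewrite IH; ring]. Qed.

Lemma lsum_plus {I} (f g : I -> C) l : lsum (fun i => f i + g i) l = lsum f l + lsum g l.
Proof. induction l as [|i l IH]; simpl; [ring|rewrite IH; ring]. Qed.

Lemma lsum_scal {I} (c : C) (f : I -> C) l : lsum (fun i => c * f i) l = c * lsum f l.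
Proof. induction l as [|i l IH]; simpl; [ring|rewrite IH; ring]. Qed.

Lemma lsum_map {I J} (h : J -> I) (f : I -> C) l : lsum f (map h l) = lsum (fun j => f (h j)) l.
Proof. induction l as [|i l IH]; simpl; [easy|rewrite IH; easy]. Qed.

Lemma lnorm_map {I J} (h : J -> I) (f : I -> C) l : lnorm f (map h l) = lnorm (fun j => f (h j)) l.
Proof. induction l as [|i l IH]; simpl; [easy|rewrite IH; easy]. Qed.

Lemma lsum_list_prod {I J} (f : I * J -> C) l l' :
  lsum f (list_prod l l') = lsum (fun i => lsum (fun j => f (i, j)) l') l.
Proof.
  induction l as [|i l IH]; simpl; [easy|].
  rewrite lsum_app, IH. f_equal. apply lsum_map.
Qed.

Lemma lnorm_ge0 {I} (f : I -> C) l : (0 <= lnorm f l)%R.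
Proof. induction l; simpl; [lra|]. generalize (Cmod_ge_0 (f a)). lra. Qed.

Lemma Cmod_lsum_le {I} (f : I -> C) l : (Cmod (lsum f l) <= lnorm f l)%R.
Proof.
  induction l as [|i l IH]; simpl; [rewrite Cmod_0; lra|].
  eapply Rle_trans; [apply Cmod_triangle|lra].
Qed.

Lemma lnorm_app {I} (f : I -> C) l l' : lnorm f (l ++ l') = (lnorm f l + lnorm f l')%R.
Proof. induction l as [|i l IH]; simpl; [ring|rewrite IH; ring]. Qed.

Lemma lnorm_incl {I} (f : I -> C) l l' :
  NoDup l -> incl l l' -> (lnorm f l <= lnorm f l')%R.
Proof.
  revert l'. induction l as [|i l IH]; intros l' Hn Hi; [apply lnorm_ge0|].
  inversion_clear Hn as [|? ? Hni Hn'].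
  destruct (in_split i l') as (a & b & ->); [apply Hi; now left|].
  assert (H : (lnorm f l <= lnorm f (a ++ b))%R).
  { apply IH; [easy|]. intros x Hx.
    specialize (Hi x (or_intror Hx)). apply in_app_or in Hi.
    apply in_or_app. destruct Hi as [|[->|]]; auto. contradiction. }
  rewrite lnorm_app in *. simpl. lra.
Qed.

Lemma lnorm_prod {I J} (f : I -> C) (g : J -> C) l l' :
  lnorm (fun p => f (fst p) * g (snd p)) (list_prod l l') = (lnorm f l * lnorm g l')%R.
Proof.
  induction l as [|i l IH]; simpl; [ring|].
  rewrite lnorm_app, IH, lnorm_map. simpl.
  assert (H : lnorm (fun j => f i * g j) l' = (Cmod (f i) * lnorm g l')%R).
  { clear. induction l' as [|j l' IH]; simpl; [ring|rewrite IH, Cmod_mult; ring]. }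
  rewrite H. ring.
Qed.

Lemma has_sum_unique {I} (f : I -> C) s t : has_sum f s -> has_sum f t -> s = t.
Proof. apply clim_unique. typeclasses eauto. Qed.

Lemma has_sum_plus {I} (f g : I -> C) s t :
  has_sum f s -> has_sum g t -> has_sum (fun i => f i + g i) (s + t).
Proof.
  intros Hf Hg. eapply clim_ext; [typeclasses eauto| |].
  - intros l. symmetry. apply lsum_plus.
  - apply clim_plus; [typeclasses eauto|exact Hf|exact Hg].
Qed.

Lemma has_sum_scal {I} (c : C) (f : I -> C) s :
  has_sum f s -> has_sum (fun i => c * f i) (c * s).
Proof.
  intros Hf. eapply clim_ext; [typeclasses eauto| |].
  - intros l. symmetry. apply lsum_scal.
  - apply clim_mult; [typeclasses eauto|apply clim_const; typeclasses eauto|exact Hf].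
Qed.

Lemma has_sum_ext {I} (f g : I -> C) s : (forall i, f i = g i) -> has_sum f s -> has_sum g s.
Proof. intros H. replace g with f; [easy|]. now apply functional_extensionality. Qed.

(** Finite sums of nonnegative terms grow with the finite set, so their supremum is the limit. *)
Lemma has_sum_nonneg {I} (g : I -> R) (M : R) :
  (forall i, (0 <= g i)%R) ->
  (forall l, NoDup l -> (lnorm (fun i => RtoC (g i)) l <= M)%R) ->
  exists s : C, has_sum (fun i => RtoC (g i)) s.
Proof.
  intros Hg HM.
  set (N := lnorm (fun i => RtoC (g i))) in *.
  assert (HN : forall l, lsum (fun i => RtoC (g i)) l = RtoC (N l)).
  { induction l as [|i l IH]; simpl; [easy|].
    rewrite IH, <- RtoC_plus, Cmod_R, Rabs_pos_eq; auto. }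
  destruct (completeness (fun x => exists l, NoDup l /\ x = N l)) as [s [Hub Hlub]].
  - exists M. intros x (l & Hl & ->). auto.
  - exists (N nil), nil. split; [constructor|easy].
  - exists s. apply clim_eps; [typeclasses eauto|]. intros e He.
    destruct (classic (exists l, NoDup l /\ (s - e < N l)%R)) as [(l0 & Hl0 & Hs)|Hno].
    + exists l0. intros l Hl Hi. rewrite HN, <- RtoC_minus, Cmod_R.
      assert (N l <= s)%R by (apply Hub; eauto).
      assert (N l0 <= N l)%R by (apply lnorm_incl; auto).
      apply Rabs_def1; lra.
    + exfalso. assert (s <= s - e)%R; [|lra].
      apply Hlub. intros x (l & Hl & ->).
      apply Rnot_lt_le. intros Hlt. apply Hno. eauto.
Qed.

Lemma summable_le {I} (f g : I -> C) :
  (forall i, (Cmod (f i) <= Cmod (g i))%R) -> summable g -> summable f.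
Proof.
  intros H [M HM]. exists M. intros l Hl.
  eapply Rle_trans; [|apply HM, Hl].
  clear Hl. induction l as [|i l IH]; simpl; [lra|]. specialize (H i). lra.
Qed.

Lemma summable_plus {I} (f g : I -> C) :
  summable f -> summable g -> summable (fun i => f i + g i).
Proof.
  intros [M HM] [N HN]. exists (M + N)%R. intros l Hl.
  specialize (HM l Hl). specialize (HN l Hl).
  eapply Rle_trans; [|apply Rplus_le_compat; eassumption].
  clear. induction l as [|i l IH]; simpl; [lra|].
  generalize (Cmod_triangle (f i) (g i)). lra.
Qed.

Lemma summable_scal {I} (c : C) (f : I -> C) : summable f -> summable (fun i => c * f i).
Proof.
  intros [M HM]. exists (Cmod c * M)%R. intros l Hl.
  apply Rle_trans with (Cmod c * lnorm f l)%R.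
  - right. clear. induction l as [|i l IH]; simpl; [ring|rewrite IH, Cmod_mult; ring].
  - apply Rmult_le_compat_l; [apply Cmod_ge_0|auto].
Qed.

Lemma summable_bounded_mult {I} (h f : I -> C) (K : R) :
  (forall i, (Cmod (h i) <= K)%R) -> summable f -> summable (fun i => h i * f i).
Proof.
  intros HK Hf. apply summable_le with (fun i => RtoC K * f i); [|now apply summable_scal].
  intros i. rewrite !Cmod_mult, Cmod_R. apply Rmult_le_compat_r; [apply Cmod_ge_0|].
  eapply Rle_trans; [apply HK|apply Rle_abs].
Qed.

Lemma summable_inj {I J} (h : J -> I) (f : I -> C) :
  (forall x y, h x = h y -> x = y) -> summable f -> summable (fun j => f (h j)).
Proof.
  intros Hinj [M HM]. exists M. intros l Hl.
  rewrite <- lnorm_map. apply HM. now apply Injective_map_NoDup.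
Qed.

Lemma summable_prod {I J} (f : I -> C) (g : J -> C) :
  summable f -> summable g -> summable (fun p : I * J => f (fst p) * g (snd p)).
Proof.
  intros [M HM] [N HN]. exists (M * N)%R. intros l Hl.
  destruct (NoDup_cover (map fst l)) as (a & Ha & Hia & _).
  destruct (NoDup_cover (map snd l)) as (b & Hb & Hib & _).
  apply Rle_trans with (lnorm (fun p : I * J => f (fst p) * g (snd p)) (list_prod a b)).
  - apply lnorm_incl; [easy|]. intros [x y] Hxy. apply in_prod.
    + apply Hia. now apply (in_map fst) in Hxy.
    + apply Hib. now apply (in_map snd) in Hxy.
  - rewrite lnorm_prod. apply Rmult_le_compat; auto; apply lnorm_ge0.
Qed.

(** Reduction to nonnegative terms: Re f + |f|, Im f + |f| and |f| all lie between 0 and 2|f|, and f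
    = (Re f + |f|) - |f| + i ((Im f + |f|) - |f|). *)
Lemma summable_has_sum {I} (f : I -> C) : summable f -> exists s, has_sum f s.
Proof.
  intros Hf.
  assert (key : forall g : I -> R, (forall i, (0 <= g i <= 2 * Cmod (f i))%R) ->
            exists s : C, has_sum (fun i => RtoC (g i)) s).
  { intros g Hg.
    destruct (summable_le (fun i => RtoC (g i)) (fun i => RtoC 2 * f i)) as [M HM].
    - intros i. rewrite Cmod_mult, !Cmod_R, !Rabs_pos_eq by (try apply Hg; lra). apply Hg.
    - now apply summable_scal.
    - apply has_sum_nonneg with M; [apply Hg|exact HM]. }
  assert (Him : forall c : C, (Rabs (Im c) <= Cmod c)%R).
  { intros c. eapply Rle_trans; [|apply Rmax_Cmod]. apply Rmax_r. }
  destruct (key (fun i => Re (f i) + Cmod (f i))%R) as [s1 H1].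
  { intros i. generalize (re_le_Cmod (f i)). intros H. apply Rabs_le_between in H. lra. }
  destruct (key (fun i => Im (f i) + Cmod (f i))%R) as [s2 H2].
  { intros i. generalize (Him (f i)). intros H. apply Rabs_le_between in H. lra. }
  destruct (key (fun i => Cmod (f i))) as [s3 H3].
  { intros i. generalize (Cmod_ge_0 (f i)). lra. }
  exists (s1 + (- (1)) * s3 + Ci * (s2 + (- (1)) * s3)).
  eapply has_sum_ext; [|apply has_sum_plus; [apply has_sum_plus; [exact H1|apply has_sum_scal, H3]|
     apply has_sum_scal, has_sum_plus; [exact H2|apply has_sum_scal, H3]]].
  intros i. simpl. destruct (f i) as [x y]. unfold Re, Im, Ci, Cplus, Cmult, Copp, RtoC. simpl.
  apply f_equal2; ring.
Qed.

(** [epsilon] makes the sum a total function; where no sum exists the value is unspecified, so the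
    rules for it carry summability or [has_sum] hypotheses. *)
Definition csum {I : Type} (f : I -> C) : C := epsilon (inhabits (RtoC 0)) (has_sum f).

Lemma csum_correct {I} (f : I -> C) : summable f -> has_sum f (csum f).
Proof. intros H. unfold csum. apply epsilon_spec, summable_has_sum, H. Qed.

Lemma csum_unique {I} (f : I -> C) s : has_sum f s -> csum f = s.
Proof.
  intros H. apply has_sum_unique with f; [|easy].
  unfold csum. apply epsilon_spec. now exists s.
Qed.

Lemma csum_ext {I} (f g : I -> C) : (forall i, f i = g i) -> csum f = csum g.
Proof. intros H. f_equal. now apply functional_extensionality. Qed.

Lemma csum_plus {I} (f g : I -> C) :
  summable f -> summable g -> csum (fun i => f i + g i) = csum f + csum g.
Proof. intros. apply csum_unique, has_sum_plus; now apply csum_correct. Qed.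

Lemma csum_scal {I} (c : C) (f : I -> C) :
  summable f -> csum (fun i => c * f i) = c * csum f.
Proof. intros. apply csum_unique, has_sum_scal; now apply csum_correct. Qed.

Lemma has_sum_bij {I J} (h : J -> I) (k : I -> J) (f : I -> C) s :
  (forall j, k (h j) = j) -> (forall i, h (k i) = i) ->
  has_sum f s -> has_sum (fun j => f (h j)) s.
Proof.
  intros Hk Hh H. unfold has_sum in *.
  rewrite clim_eps in H by typeclasses eauto; rewrite clim_eps by typeclasses eauto. intros e He.
  destruct (H e He) as [l0 H0]. exists (map k l0). intros l Hl Hi.
  rewrite <- lsum_map. apply H0.
  - apply Injective_map_NoDup; [|easy]. intros x y E.
    now rewrite <- (Hk x), <- (Hk y), E.
  - intros x Hx. rewrite <- (Hh x). apply in_map, Hi, in_map, Hx.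
Qed.

Lemma csum_bij {I J} (h : J -> I) (k : I -> J) (f : I -> C) :
  (forall j, k (h j) = j) -> (forall i, h (k i) = i) -> summable f ->
  csum (fun j => f (h j)) = csum f.
Proof. intros. apply csum_unique, has_sum_bij with k; auto. now apply csum_correct. Qed.

Lemma NoDup_list_prod {I J} (a : list I) (b : list J) :
  NoDup a -> NoDup b -> NoDup (list_prod a b).
Proof.
  intros Ha Hb. induction Ha as [|i a Hi Ha IH]; simpl; [constructor|].
  apply NoDup_app; [|exact IH|].
  - apply Injective_map_NoDup; [|easy]. intros x y E. now inversion E.
  - intros [x y] H1 H2. apply in_map_iff in H1. destruct H1 as (z & E & _).
    inversion E; subst. apply in_prod_iff in H2. tauto.
Qed.

(** Given a finite set [a] of rows, choose a finite set [b] of columns that nearly exhausts each of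
    these rows and also covers the columns of [l0]. The rectangle [a] x [b] is then close both to
    the total sum and to the sum of the row sums over [a]. *)
Lemma has_sum_fubini {I J} (f : I * J -> C) (g : I -> C) s :
  has_sum f s -> (forall i, has_sum (fun j => f (i, j)) (g i)) -> has_sum g s.
Proof.
  intros Hf Hg. unfold has_sum in Hf |- *. rewrite clim_eps in Hf by typeclasses eauto; rewrite clim_eps by typeclasses eauto.
  intros e He. destruct (Hf (e / 2)%R ltac:(lra)) as [l0 H0].
  exists (map fst l0). intros a Ha Hia.
  assert (Hn : (0 < INR (length a) + 1)%R) by (generalize (pos_INR (length a)); lra).
  (* Tolerance per row: the errors of all rows in [a] add up to at most e/2. The added 1 covers an
     empty [a]. *)
  set (d := (e / 2 / (INR (length a) + 1))%R).
  assert (Hd : (0 < d)%R) by (apply Rdiv_lt_0_compat; lra).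
  assert (Hev : finlists J (fun b => forall i, In i a ->
             (Cmod (lsum (fun j => f (i, j)) b - g i) < d)%R)).
  { clearbody d. clear - Hg Hd. induction a as [|i a IH].
    - apply filter_forall. easy.
    - specialize (Hg i). unfold has_sum in Hg. rewrite clim_eps in Hg by typeclasses eauto.
      generalize (filter_and _ _ (Hg d Hd) IH). apply filter_imp.
      intros b [H1 H2] x [<-|Hx]; auto. }
  assert (Hsnd : finlists J (fun b => NoDup b /\ incl (map snd l0) b)).
  { exists (map snd l0). auto. }
  destruct (filter_ex _ (filter_and _ _ Hev Hsnd)) as (b & Hb & Hbn & Hib).
  specialize (H0 (list_prod a b)).
  assert (H1 : (Cmod (lsum f (list_prod a b) - s) < e / 2)%R).
  { apply H0.
    - now apply NoDup_list_prod.
    - intros [x y] Hxy. apply in_prod.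
      + apply Hia. now apply (in_map fst) in Hxy.
      + apply Hib. now apply (in_map snd) in Hxy. }
  rewrite lsum_list_prod in H1.
  assert (H2 : (Cmod (lsum g a - lsum (fun i => lsum (fun j => f (i, j)) b) a) <= INR (length a) * d)%R).
  { clearbody d. clear - Hb. induction a as [|i a IH].
    - simpl. replace (0 - 0)%C with (RtoC 0) by ring. rewrite Cmod_0. lra.
    - simpl length. rewrite S_INR. simpl lsum.
      match goal with |- (Cmod (?x + ?y - (?z + ?w)) <= _)%R =>
        replace (x + y - (z + w)) with (- (z - x) + (y - w)) by ring end.
      eapply Rle_trans; [apply Cmod_triangle|]. rewrite Cmod_opp.
      specialize (IH ltac:(intros; apply Hb; now right)).
      specialize (Hb i (or_introl eq_refl)). lra. }
  match type of H1 with (Cmod (?w - _) < _)%R =>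
    replace (lsum g a - s) with ((lsum g a - w) + (w - s)) by ring end.
  eapply Rle_lt_trans; [apply Cmod_triangle|].
  assert (INR (length a) * d <= e / 2)%R; [|lra].
  assert (E : (e / 2 = (INR (length a) + 1) * d)%R) by (unfold d; field; lra).
  rewrite E. apply Rmult_le_compat_r; lra.
Qed.

Lemma summable_slice {I J} (f : I * J -> C) i : summable f -> summable (fun j => f (i, j)).
Proof. apply (summable_inj (fun j => (i, j))). intros x y E. now inversion E. Qed.

Lemma summable_swap {I J} (f : I * J -> C) : summable f -> summable (fun p => f (snd p, fst p)).
Proof.
  apply (summable_inj (fun p : J * I => (snd p, fst p))).
  intros [] [] E. now inversion E.
Qed.

Lemma has_sum_csum_slices {I J} (f : I * J -> C) :
  summable f -> has_sum (fun i => csum (fun j => f (i, j))) (csum f).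
Proof.
  intros H. apply has_sum_fubini with f; [now apply csum_correct|].
  intros i. now apply csum_correct, summable_slice.
Qed.

Lemma csum_fubini {I J} (f : I * J -> C) :
  summable f -> csum (fun i => csum (fun j => f (i, j))) = csum f.
Proof. intros H. now apply csum_unique, has_sum_csum_slices. Qed.

Lemma csum_prod {I J} (f : I -> C) (g : J -> C) : summable f -> summable g ->
  csum (fun p : I * J => f (fst p) * g (snd p)) = csum f * csum g.
Proof.
  intros Hf Hg. rewrite <- csum_fubini by now apply summable_prod. simpl.
  rewrite (csum_ext _ (fun i => csum g * f i)).
  - rewrite csum_scal by easy. ring.
  - intros i. rewrite csum_scal by easy. ring.
Qed.

Lemma csum_opp {I} (f : I -> C) : summable f -> csum (fun i => - f i) = - csum f.
Proof.
  intros. rewrite (csum_ext _ (fun i => (- (1)) * f i)) by (intros; ring).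
  rewrite csum_scal by easy. ring.
Qed.

Lemma Cmod_csum_le {I} (f : I -> C) (M : R) :
  (forall l, NoDup l -> (lnorm f l <= M)%R) -> (Cmod (csum f) <= M)%R.
Proof.
  intros HM. assert (H : has_sum f (csum f)) by (apply csum_correct; now exists M).
  destruct (Rle_dec (Cmod (csum f)) M) as [|Hn]; [easy|exfalso].
  unfold has_sum in H. rewrite clim_eps in H by typeclasses eauto.
  specialize (H (Cmod (csum f) - M)%R ltac:(lra)).
  assert (Hnd : finlists I (fun l => NoDup l)) by (exists nil; auto).
  destruct (filter_ex _ (filter_and _ _ H Hnd)) as (l & Hx & Hl).
  specialize (HM l Hl). generalize (Cmod_lsum_le f l). intros Hle.
  assert (Cmod (csum f) <= Cmod (lsum f l) + Cmod (lsum f l - csum f))%R; [|lra].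
  replace (csum f) with (lsum f l + - (lsum f l - csum f)) at 1 by ring.
  rewrite <- (Cmod_opp (lsum f l - csum f)). apply Cmod_triangle.
Qed.

(** The constant depends on [f] alone, which gives bounds uniform in m when [h] is a family of
    translates of [Bq]. *)
Lemma csum_mult_bounded {I} (f : I -> C) : summable f ->
  exists M, forall (h : I -> C) (K : R), (0 <= K)%R -> (forall i, (Cmod (h i) <= K)%R) ->
  (Cmod (csum (fun i => f i * h i)%C) <= M * K)%R.
Proof.
  intros [M HM]. exists M. intros h K HK0 HK. apply Cmod_csum_le. intros l Hl.
  eapply Rle_trans; [|apply Rmult_le_compat_r; [easy|apply (HM l Hl)]].
  clear Hl. induction l as [|k l IH]; simpl; [lra|].
  rewrite Rmult_plus_distr_r. apply Rplus_le_compat; [|exact IH].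
  rewrite Cmod_mult. apply Rmult_le_compat_l; [apply Cmod_ge_0|auto].
Qed.

Lemma has_sum_single {I} (f : I -> C) i0 : (forall i, i <> i0 -> f i = 0) -> has_sum f (f i0).
Proof.
  intros H. apply clim_eps; [typeclasses eauto|]. intros e He.
  exists (i0 :: nil). intros l Hl Hi.
  assert (E : lsum f l = f i0).
  { specialize (Hi i0 (or_introl eq_refl)).
    destruct (in_split _ _ Hi) as (a & b & ->).
    apply NoDup_remove_2 in Hl. rewrite lsum_app. simpl.
    assert (Z : forall c, ~ In i0 c -> lsum f c = 0).
    { induction c as [|x c IH]; simpl; intros Hc; [easy|].
      rewrite H, IH by intuition. ring. }
    rewrite !Z by (intros Hc; apply Hl, in_or_app; auto). ring. }
  rewrite E. replace (f i0 - f i0) with (RtoC 0) by ring. now rewrite Cmod_0.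
Qed.

(** * Comparison with ordinary series over nat and Z *)

(** A sequence of finite sets that eventually contains each index also eventually contains any given
    finite set, so it computes the same sum. *)
Lemma has_sum_along {I} (f : I -> C) (s : C) (L : nat -> list I) :
  (forall n, NoDup (L n)) ->
  (forall i, exists N, forall n, (N <= n)%nat -> In i (L n)) ->
  has_sum f s -> clim eventually (fun n => lsum f (L n)) s.
Proof.
  intros Hn HL H. unfold has_sum in H. rewrite clim_eps in H by typeclasses eauto; rewrite clim_eps by typeclasses eauto.
  intros e He. destruct (H e He) as [l0 H0].
  assert (E : exists N, forall n, (N <= n)%nat -> incl l0 (L n)).
  { clear - HL. induction l0 as [|i l0 [N HN]].
    - exists O. intros n _ x [].
    - destruct (HL i) as [M HM]. exists (max N M). intros n Hnm x [<-|Hx].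
      + apply HM. lia.
      + apply HN; [lia|easy]. }
  destruct E as [N HN]. exists N. intros n Hle. apply H0; auto.
Qed.

Lemma sum_n_lsum (f : nat -> C) n :
  @sum_n C_AbelianMonoid f n = lsum f (seq 0 (S n)).
Proof.
  induction n as [|n IH].
  - rewrite sum_O. simpl. ring.
  - rewrite sum_Sn, IH, (seq_S (S n)), lsum_app. simpl. unfold plus. simpl. ring.
Qed.

Lemma has_sum_seq (f : nat -> C) s :
  has_sum f s -> clim eventually (fun n => lsum f (seq 0 (S n))) s.
Proof.
  apply has_sum_along.
  - intros n. apply seq_NoDup.
  - intros i. exists i. intros n Hn. apply in_seq. lia.
Qed.

Lemma csum_nat_S (f : nat -> C) : summable f -> csum f = f O + csum (fun n => f (S n)).
Proof.
  intros Hf.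
  assert (Hs : summable (fun n => f (S n))) by (apply (summable_inj S); [intros; lia|easy]).
  apply csum_correct in Hf. apply csum_correct in Hs.
  apply has_sum_seq in Hs. apply has_sum_seq in Hf.
  apply clim_unique with (F := eventually) (f := fun n => lsum f (seq 0 (S (n + 1)))).
  - typeclasses eauto.
  - rewrite clim_eps in Hf by typeclasses eauto. rewrite clim_eps by typeclasses eauto.
    intros e He. destruct (Hf e He) as [N HN]. exists N. intros n Hn. apply HN. lia.
  - eapply clim_ext; [typeclasses eauto| |apply clim_plus; [typeclasses eauto|
      apply (clim_const eventually (f O))|exact Hs]].
    intros n. cbv beta. rewrite Nat.add_1_r. change (seq 0 (S (S n))) with (0%nat :: seq 1 (S n)).
    rewrite <- seq_shift. simpl lsum. now rewrite lsum_map.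
Qed.

Lemma has_sum_is_Cseries (f : nat -> C) s : has_sum f s -> is_Cseries f s.
Proof.
  intros H. apply has_sum_seq in H. unfold is_Cseries, is_series.
  eapply filterlim_ext; [|exact H]. intros n. symmetry. apply sum_n_lsum.
Qed.

Lemma has_sum_is_Zseries (f : Z -> C) : summable f -> is_Zseries f (csum f).
Proof.
  intros Hf.
  assert (H1 : summable (fun n => f (Z.of_nat n))).
  { apply (summable_inj Z.of_nat); [intros; lia|easy]. }
  assert (H2 : summable (fun n => f (- Z.of_nat (S n))%Z)).
  { apply (summable_inj (fun n => (- Z.of_nat (S n))%Z)); [intros; lia|easy]. }
  apply csum_correct in H1. apply csum_correct in H2.
  eexists _, _. split; [apply has_sum_is_Cseries, H1|]. split; [apply has_sum_is_Cseries, H2|].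
  (* The windows from -(n+1) to n exhaust Z, and each splits into one partial sum of either
     half-series. *)
  apply clim_unique with (F := eventually)
    (f := fun n => lsum f (map Z.of_nat (seq 0 (S n)) ++ map (fun n => - Z.of_nat (S n))%Z (seq 0 (S n)))).
  - typeclasses eauto.
  - apply (has_sum_along f (csum f) (fun n => map Z.of_nat (seq 0 (S n)) ++
      map (fun n => - Z.of_nat (S n))%Z (seq 0 (S n)))).
    + intros n. apply NoDup_app.
      * apply Injective_map_NoDup; [intros x y; lia|apply seq_NoDup].
      * apply Injective_map_NoDup; [intros x y; lia|apply seq_NoDup].
      * intros x Hx Hy. apply in_map_iff in Hx, Hy.
        destruct Hx as (a & Ha & _), Hy as (b & Hb & _). lia.
    + intros z. exists (Z.abs_nat z). intros n Hn. apply in_or_app.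
      destruct (Z_le_gt_dec 0 z) as [Hz|Hz]; [left|right]; apply in_map_iff.
      * exists (Z.abs_nat z). split; [lia|]. apply in_seq. lia.
      * exists (Z.abs_nat z - 1)%nat. split; [lia|]. apply in_seq. lia.
    + now apply csum_correct.
  - apply has_sum_seq in H1. apply has_sum_seq in H2.
    eapply clim_ext; [typeclasses eauto| |apply clim_plus; [typeclasses eauto|exact H1|exact H2]].
    intros n. cbv beta. now rewrite lsum_app, !lsum_map.
Qed.

(** * Geometric series *)

Lemma lnorm_geom_le (r : R) (l : list nat) : (0 <= r < 1)%R -> NoDup l ->
  (lnorm (fun n : nat => (RtoC r ^ n)%C) l <= / (1 - r))%R.
Proof.
  intros Hr Hl.
  assert (HN : exists N, incl l (seq 0 N)).
  { clear Hl. induction l as [|i l [N HN]]; [exists O; intros x []|].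
    exists (max N (S i)). intros x [<-|Hx]; apply in_seq; [lia|].
    apply HN, in_seq in Hx. lia. }
  destruct HN as [N HN].
  eapply Rle_trans; [apply lnorm_incl; eassumption|].
  assert (E : (lnorm (fun n : nat => (RtoC r ^ n)%C) (seq 0 N) * (1 - r) = 1 - r ^ N)%R).
  { clear - Hr. induction N as [|N IH]; [simpl; ring|].
    rewrite seq_S, lnorm_app, Rmult_plus_distr_r, IH. simpl.
    rewrite Cmod_pow, Cmod_R, Rabs_pos_eq by lra. ring. }
  apply Rmult_le_reg_r with (1 - r)%R; [lra|]. rewrite E, Rinv_l by lra.
  generalize (pow_le r N ltac:(lra)). lra.
Qed.

Lemma summable_geom (q : C) : (Cmod q < 1)%R -> summable (fun n => q ^ n).
Proof.
  intros Hq. generalize (Cmod_ge_0 q). intros Hq0.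
  apply summable_le with (fun n => RtoC (Cmod q) ^ n).
  - intros n. rewrite !Cmod_pow, Cmod_R, Rabs_pos_eq; lra.
  - exists (/ (1 - Cmod q))%R. intros l. apply lnorm_geom_le. lra.
Qed.

(** Sending m to its positive and negative parts embeds Z into pairs of naturals and turns q^|m|
    into a term of the product of two geometric series. *)
Lemma summable_geom_Z (q : C) : (Cmod q < 1)%R -> summable (fun m => q ^ Z.abs_nat m).
Proof.
  intros Hq.
  apply summable_le with (fun m => q ^ Z.to_nat m * q ^ Z.to_nat (- m)).
  - intros m. rewrite <- Cpow_add_r. right. do 2 f_equal. lia.
  - apply (summable_inj (fun m => (Z.to_nat m, Z.to_nat (- m)))
             (fun p : nat * nat => q ^ fst p * q ^ snd p)).
    + intros x y E. inversion E. lia.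
    + apply (summable_prod (fun n => q ^ n) (fun n => q ^ n)); now apply summable_geom.
Qed.

(** * The coefficients of the reciprocal theta function *)

Definition uq (q : C) (n : nat) : C := / qpoch q q n.
(** Euler's series for 1/(q;q)_oo; [uq_limit] and [qpoch_limit] justify this reading. *)
Definition vq (q : C) : C := csum (fun n => q ^ n * uq q n).
(** Obtained by multiplying the Euler expansions of 1/(z;q)_oo and 1/(q/z;q)_oo and collecting z^k
    for k >= 0. *)
Definition bq (q : C) (k : nat) : C := csum (fun n => q ^ n * (uq q n * uq q (n + k))).

(* [Bq q j] is the coefficient of [z^j] in [1 / ((z;q)_oo (q/z;q)_oo)] on [|q| < |z| < 1]. *)
Definition Bq (q : C) (j : Z) : C := q ^ Z.to_nat (- j) * bq q (Z.abs_nat j).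

(** * Bounds and limits of the finite products *)

Lemma Cpown_pow (x : C) n : Cpown x n = x ^ n.
Proof. induction n as [|n IH]; simpl; [easy|]. now rewrite IH. Qed.

Lemma Cmod_pow_le1 (q : C) n : (Cmod q < 1)%R -> (Cmod (q ^ n) <= 1)%R.
Proof.
  intros Hq. rewrite Cmod_pow. rewrite <- (pow1 n). apply pow_incr.
  generalize (Cmod_ge_0 q). lra.
Qed.

Lemma qpoch_S (q : C) n : qpoch q q (S n) = qpoch q q n * (1 - q ^ S n).
Proof. simpl. now rewrite Cpown_pow. Qed.

Lemma pow_S_lt1 (r : R) n : (0 <= r < 1)%R -> (0 <= r ^ S n <= r)%R.
Proof.
  intros Hr. simpl. generalize (pow_le r n (proj1 Hr)). intros H.
  assert (r ^ n <= 1)%R by (rewrite <- (pow1 n); apply pow_incr; lra). nra.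
Qed.

Lemma Cmod_1_minus_pow_ge (q : C) n : (1 - Cmod q ^ S n <= Cmod (1 - q ^ S n))%R.
Proof.
  rewrite <- Cmod_pow. set (x := q ^ S n).
  assert (Cmod 1 <= Cmod (1 - x) + Cmod x)%R.
  { replace (RtoC 1) with ((1 - x) + x) at 1 by ring. apply Cmod_triangle. }
  rewrite Cmod_1 in H. lra.
Qed.

Lemma one_minus_pow_neq0 (q : C) n : (Cmod q < 1)%R -> 1 - q ^ S n <> 0.
Proof.
  intros Hq. apply Cmod_gt_0. eapply Rlt_le_trans; [|apply Cmod_1_minus_pow_ge].
  generalize (pow_S_lt1 (Cmod q) n (conj (Cmod_ge_0 q) Hq)). lra.
Qed.

Lemma qpoch_neq0 (q : C) n : (Cmod q < 1)%R -> qpoch q q n <> 0.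
Proof.
  intros Hq. induction n as [|n IH].
  - simpl. intros E. apply RtoC_inj in E. lra.
  - rewrite qpoch_S. apply Cmult_neq_0; [easy|]. now apply one_minus_pow_neq0.
Qed.

Lemma uq_0 (q : C) : uq q 0 = 1.
Proof. unfold uq. simpl. field. Qed.

Lemma uq_step (q : C) n : (Cmod q < 1)%R -> uq q n = uq q (S n) * (1 - q ^ S n).
Proof.
  intros Hq. unfold uq. rewrite qpoch_S. field.
  split; [now apply one_minus_pow_neq0|now apply qpoch_neq0].
Qed.

(** Each factor has modulus at most 1 + r^(n+1) <= exp(r^(n+1)); the exponents add up to a partial
    geometric sum. *)
Lemma qpoch_bounded (q : C) : (Cmod q < 1)%R -> exists K, forall n, (Cmod (qpoch q q n) <= K)%R.
Proof.
  intros Hq. generalize (Cmod_ge_0 q). intros Hq0. set (r := Cmod q) in *.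
  exists (exp (r / (1 - r))).
  assert (H : forall n, (Cmod (qpoch q q n) <= exp ((1 - r ^ n) * r / (1 - r)))%R).
  { induction n as [|n IH].
    - simpl. rewrite Cmod_1. replace ((1 - 1) * r / (1 - r))%R with 0%R by (field; lra).
      rewrite exp_0. lra.
    - rewrite qpoch_S, Cmod_mult.
      replace ((1 - r ^ S n) * r / (1 - r))%R with ((1 - r ^ n) * r / (1 - r) + r ^ S n)%R
        by (simpl; field; lra).
      rewrite exp_plus. apply Rmult_le_compat; [apply Cmod_ge_0|apply Cmod_ge_0|easy|].
      eapply Rle_trans; [apply Cmod_triangle|]. rewrite Cmod_1, Cmod_opp, Cmod_pow.
      fold r. apply exp_ineq1_le. }
  intros n. eapply Rle_trans; [apply H|].
  assert (E : ((1 - r ^ n) * r / (1 - r) <= r / (1 - r))%R).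
  { unfold Rdiv. apply Rmult_le_compat_r; [apply Rlt_le, Rinv_0_lt_compat; lra|].
    generalize (pow_le r n Hq0). nra. }
  destruct E as [E|E]; [left; now apply exp_increasing|right; now rewrite E].
Qed.

Lemma uq_bounded (q : C) : (Cmod q < 1)%R ->
  exists K, (0 <= K)%R /\ forall n, (Cmod (uq q n) <= K)%R.
Proof.
  intros Hq. generalize (Cmod_ge_0 q). intros Hq0. set (r := Cmod q) in *.
  exists (exp (r / (1 - r) / (1 - r))). split; [apply Rlt_le, exp_pos|].
  assert (H : forall n, (Cmod (uq q n) <= exp ((1 - r ^ n) * r / (1 - r) / (1 - r)))%R).
  { induction n as [|n IH].
    - rewrite uq_0. simpl. rewrite Cmod_1.
      replace ((1 - 1) * r / (1 - r) / (1 - r))%R with 0%R by (field; lra).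
      rewrite exp_0. lra.
    - rewrite (uq_step q n Hq), Cmod_mult in IH.
      generalize (Cmod_1_minus_pow_ge q n). fold r. intros Hge.
      destruct (pow_S_lt1 r n (conj Hq0 Hq)) as [Hx0 Hx1].
      replace ((1 - r ^ S n) * r / (1 - r) / (1 - r))%R
        with ((1 - r ^ n) * r / (1 - r) / (1 - r) + r ^ S n / (1 - r))%R
        by (simpl; field; lra).
      set (E := exp ((1 - r ^ n) * r / (1 - r) / (1 - r))) in *.
      assert (HE : (0 < E)%R) by apply exp_pos.
      rewrite exp_plus. fold E. set (x := (r ^ S n)%R) in *.
      (* The reciprocal factor 1/(1 - x) is at most exp(x/(1 - r)) for 0 <= x <= r, because (1 -
         x)(1 + x/(1 - r)) = 1 + x(r - x)/(1 - r). *)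
      assert (Hi : (1 <= (1 - x) * exp (x / (1 - r)))%R).
      { apply Rle_trans with ((1 - x) * (1 + x / (1 - r)))%R.
        - assert (0 <= x * (r - x) / (1 - r))%R.
          { apply Rmult_le_pos; [nra|]. apply Rlt_le, Rinv_0_lt_compat. lra. }
          replace ((1 - x) * (1 + x / (1 - r)))%R with (1 + x * (r - x) / (1 - r))%R
            by (field; lra). lra.
        - apply Rmult_le_compat_l; [lra|]. apply exp_ineq1_le. }
      set (F := exp (x / (1 - r))) in *.
      assert (HF : (0 < F)%R) by apply exp_pos.
      generalize (Cmod_ge_0 (uq q (S n))). intros Hu. set (u := Cmod (uq q (S n))) in *.
      assert (u * (1 - x) <= E)%R by (eapply Rle_trans; [apply Rmult_le_compat_l|]; eauto).
      apply Rle_trans with (u * ((1 - x) * F))%R.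
      + rewrite <- (Rmult_1_r u) at 1. now apply Rmult_le_compat_l.
      + rewrite <- Rmult_assoc. apply Rmult_le_compat_r; lra. }
  intros n. eapply Rle_trans; [apply H|].
  assert (E : ((1 - r ^ n) * r / (1 - r) / (1 - r) <= r / (1 - r) / (1 - r))%R).
  { assert (0 < / (1 - r))%R by (apply Rinv_0_lt_compat; lra).
    unfold Rdiv. do 2 (apply Rmult_le_compat_r; [lra|]).
    generalize (pow_le r n Hq0). nra. }
  destruct E as [E|E]; [left; now apply exp_increasing|right; now rewrite E].
Qed.

Lemma summable_geom_mult (q : C) (h : nat -> C) (K : R) : (Cmod q < 1)%R ->
  (forall n, (Cmod (h n) <= K)%R) -> summable (fun n => q ^ n * h n).
Proof.
  intros Hq HK. replace (fun n => q ^ n * h n) with (fun n => h n * q ^ n)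
    by (apply functional_extensionality; intros; ring).
  apply summable_bounded_mult with K; [easy|]. now apply summable_geom.
Qed.

Lemma Cmod_csum_geom_le (q : C) (h : nat -> C) (K : R) : (Cmod q < 1)%R ->
  (forall n, (Cmod (h n) <= K)%R) -> (Cmod (csum (fun n => q ^ n * h n)%C) <= K / (1 - Cmod q))%R.
Proof.
  intros Hq HK. apply Cmod_csum_le. intros l Hl.
  assert (HK0 : (0 <= K)%R) by (eapply Rle_trans; [apply Cmod_ge_0|apply (HK O)]).
  apply Rle_trans with (K * lnorm (fun n : nat => (RtoC (Cmod q) ^ n)%C) l)%R.
  - clear Hl. induction l as [|n l IH]; simpl; [lra|].
    rewrite Cmod_mult, !Cmod_pow, Cmod_R, Rabs_pos_eq by apply Cmod_ge_0.
    assert (Cmod q ^ n * Cmod (h n) <= Cmod q ^ n * K)%R; [|lra].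
    apply Rmult_le_compat_l; [apply pow_le, Cmod_ge_0|easy].
  - apply Rmult_le_compat_l; [easy|]. apply lnorm_geom_le; [|easy].
    split; [apply Cmod_ge_0|easy].
Qed.

Lemma uq_prod_bounded (q : C) : (Cmod q < 1)%R ->
  exists K, forall n k, (Cmod (uq q n * uq q k) <= K)%R.
Proof.
  intros Hq. destruct (uq_bounded q Hq) as (K & HK0 & HK). exists (K * K)%R.
  intros n k. rewrite Cmod_mult. apply Rmult_le_compat; auto; apply Cmod_ge_0.
Qed.

(** The series telescopes: [uq_step] says that its general term is the difference of consecutive
    values of [uq], so its partial sums are the values themselves. *)
Lemma uq_limit (q : C) : (Cmod q < 1)%R -> clim eventually (uq q) (vq q).
Proof.
  intros Hq. destruct (uq_bounded q Hq) as (K & _ & HK).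
  assert (Hs : summable (fun n => q ^ n * uq q n)) by now apply summable_geom_mult with K.
  apply csum_correct in Hs. apply has_sum_seq in Hs.
  eapply clim_ext; [typeclasses eauto| |exact Hs].
  induction x as [|n IH].
  - simpl. rewrite uq_0. ring.
  - cbv beta in *. rewrite seq_S, lsum_app, IH, (uq_step q n Hq). simpl. ring.
Qed.

(** A zero limit of [uq] would make its reciprocal [qpoch] unbounded. *)
Lemma vq_neq0 (q : C) : (Cmod q < 1)%R -> vq q <> 0.
Proof.
  intros Hq E. destruct (qpoch_bounded q Hq) as [K HK].
  generalize (uq_limit q Hq). rewrite E, clim_eps by typeclasses eauto. intros H.
  assert (HK0 : (0 < K)%R).
  { eapply Rlt_le_trans; [|apply (HK O)]. simpl. rewrite Cmod_1. lra. }
  destruct (H (/ K)%R (Rinv_0_lt_compat _ HK0)) as [N HN].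
  specialize (HN N (Nat.le_refl N)). replace (uq q N - 0) with (uq q N) in HN by ring.
  unfold uq in HN. rewrite Cmod_inv in HN by now apply qpoch_neq0.
  assert (Hp : (0 < Cmod (qpoch q q N))%R) by now apply Cmod_gt_0, qpoch_neq0.
  apply Rinv_lt_cancel in HN; [|easy]. specialize (HK N). lra.
Qed.

Lemma qpoch_limit (q : C) : (Cmod q < 1)%R -> is_qpoch_inf q q (/ vq q).
Proof.
  intros Hq. change (clim eventually (qpoch q q) (/ vq q)).
  eapply clim_ext; [typeclasses eauto| |apply clim_inv; [typeclasses eauto|now apply vq_neq0|
    now apply uq_limit]].
  intros n. unfold uq. cbv beta. field. now apply qpoch_neq0.
Qed.

Lemma summable_bq (q : C) k : (Cmod q < 1)%R ->
  summable (fun n => q ^ n * (uq q n * uq q (n + k))).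
Proof.
  intros Hq. destruct (uq_prod_bounded q Hq) as [K HK].
  apply summable_geom_mult with K; auto.
Qed.

Lemma bq_bounded (q : C) : (Cmod q < 1)%R -> exists K, (0 <= K)%R /\ forall k, (Cmod (bq q k) <= K)%R.
Proof.
  intros Hq. destruct (uq_prod_bounded q Hq) as [K HK].
  assert (H : forall k, (Cmod (bq q k) <= K / (1 - Cmod q))%R).
  { intros k. apply Cmod_csum_geom_le; auto. }
  eexists; split; [|exact H]. eapply Rle_trans; [apply Cmod_ge_0|apply (H O)].
Qed.

Lemma clim_eventually_shift (f : nat -> C) l k :
  clim eventually f l -> clim eventually (fun n => f (n + k)%nat) l.
Proof.
  rewrite !clim_eps by typeclasses eauto. intros H e He. destruct (H e He) as [N HN].
  exists N. intros n Hn. apply HN. lia.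
Qed.

(* The combined series telescopes: its partial sums are [uq N * uq (N + k + 1)]. *)
Lemma bq_rec (q : C) k : (Cmod q < 1)%R -> bq q k + q ^ S k * bq q (S k) = vq q * vq q.
Proof.
  intros Hq.
  generalize (summable_bq q k Hq), (summable_bq q (S k) Hq). intros H1 H2.
  apply csum_correct in H1. apply csum_correct in H2.
  apply clim_unique with (F := eventually) (f := fun N => uq q N * uq q (N + S k)%nat).
  - typeclasses eauto.
  - generalize (has_sum_seq _ _ (has_sum_plus _ _ _ _ H1 (has_sum_scal (q ^ S k) _ _ H2))).
    apply clim_ext; [typeclasses eauto|].
    induction x as [|n IH].
    + simpl. rewrite uq_0, (uq_step q k Hq). simpl. ring.
    + cbv beta in *. rewrite seq_S, lsum_app, IH, (uq_step q n Hq). simpl lsum.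
      change (0 + S n)%nat with (S n).
      change (S n + k)%nat with (S (n + k)).
      replace (n + S k)%nat with (S (n + k)) by lia.
      rewrite (uq_step q (S (n + k)) Hq).
      replace (S (S (n + k))) with (S n + S k)%nat by lia.
      rewrite (Cpow_add_r q (S n) (S k)). simpl Cpow. ring.
  - apply clim_mult; [typeclasses eauto|now apply uq_limit|].
    apply clim_eventually_shift. now apply uq_limit.
Qed.

Lemma Bq_nat (q : C) n : Bq q (Z.of_nat n) = bq q n.
Proof.
  unfold Bq. rewrite Zabs2Nat.id. replace (Z.to_nat (- Z.of_nat n)) with O by lia. simpl. ring.
Qed.

Lemma Bq_nat_opp (q : C) n : Bq q (- Z.of_nat n) = q ^ n * bq q n.
Proof.
  unfold Bq. replace (Z.to_nat (- - Z.of_nat n)) with n by lia.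
  now replace (Z.abs_nat (- Z.of_nat n)) with n by lia.
Qed.

Lemma Bq_complement (q : C) j : (Cmod q < 1)%R -> Bq q j + Bq q (-1 - j) = vq q * vq q.
Proof.
  intros Hq.
  assert (H : forall n, Bq q (Z.of_nat n) + Bq q (- Z.of_nat (S n)) = vq q * vq q).
  { intros n. rewrite Bq_nat, Bq_nat_opp. now apply bq_rec. }
  destruct (Z_le_gt_dec 0 j) as [Hj|Hj].
  - rewrite <- (H (Z.to_nat j)). f_equal; f_equal; lia.
  - rewrite <- (H (Z.to_nat (-1 - j))), Cplus_comm. f_equal; f_equal; lia.
Qed.

(* This is [Bq q (- j) = q^j Bq q j], multiplied by [q^e] so that no negative power occurs. *)
Lemma Bq_opp (q : C) e j : (0 <= e)%Z -> (0 <= e + j)%Z ->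
  q ^ Z.to_nat e * Bq q (- j) = q ^ Z.to_nat (e + j) * Bq q j.
Proof.
  intros He Hej. unfold Bq. rewrite !Cmult_assoc, <- !Cpow_add_r. f_equal.
  - f_equal. lia.
  - f_equal. lia.
Qed.

Lemma Bq_bounded (q : C) : (Cmod q < 1)%R -> exists K, (0 <= K)%R /\ forall j, (Cmod (Bq q j) <= K)%R.
Proof.
  intros Hq. destruct (bq_bounded q Hq) as (K & HK0 & HK). exists K. split; [easy|].
  intros j. unfold Bq. rewrite Cmod_mult. rewrite <- (Rmult_1_l K).
  apply Rmult_le_compat; auto; try apply Cmod_ge_0. now apply Cmod_pow_le1.
Qed.

(** Iteration gives |x_n| <= r^N |x_(n+N)| <= r^N K, which tends to 0. This is the uniqueness
    principle behind both [bq_square] and [conv_eq]: a recurrence that determines x_n from x_(n+1)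
    needs no initial value, only boundedness. *)
Lemma bounded_expanding_eq0 (x : nat -> C) (r K : R) : (0 <= r < 1)%R ->
  (forall n, (Cmod (x n) <= K)%R) -> (forall n, (Cmod (x n) <= r * Cmod (x (S n)))%R) ->
  forall n, x n = 0.
Proof.
  intros Hr HK Hx n. apply Cmod_eq_0.
  assert (H : forall N, (Cmod (x n) <= r ^ N * Cmod (x (n + N)%nat))%R).
  { induction N as [|N IH].
    - rewrite Nat.add_0_r. simpl. lra.
    - eapply Rle_trans; [exact IH|]. rewrite <- plus_n_Sm. simpl.
      rewrite (Rmult_comm r), Rmult_assoc. apply Rmult_le_compat_l; [apply pow_le; lra|apply Hx]. }
  assert (HK0 : (0 <= K)%R) by (eapply Rle_trans; [apply Cmod_ge_0|apply (HK O)]).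
  apply Rle_antisym; [|apply Cmod_ge_0]. apply Rnot_lt_le. intros Hlt.
  destruct (pow_lt_1_zero r ltac:(rewrite Rabs_pos_eq; lra) (Cmod (x n) / (K + 1))%R) as [N HN].
  { apply Rdiv_lt_0_compat; lra. }
  specialize (HN N (Nat.le_refl N)). specialize (H N). specialize (HK (n + N)%nat).
  rewrite Rabs_pos_eq in HN by (apply pow_le; lra).
  assert (r ^ N * (K + 1) < Cmod (x n))%R.
  { apply Rmult_lt_reg_r with (/ (K + 1))%R; [apply Rinv_0_lt_compat; lra|].
    rewrite Rmult_assoc, Rinv_r, Rmult_1_r by lra. exact HN. }
  generalize (pow_le r N (proj1 Hr)). nra.
Qed.

(** * The squares of the coefficients *)

(* The base is enlarged to [max |q| 1/2 > 0] so that the constant [c] can be divided out. *)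
Lemma summable_pow_ge {I} (q : C) (w E : I -> nat) (c : nat) : (Cmod q < 1)%R ->
  (forall s : C, (Cmod s < 1)%R -> summable (fun i => s ^ w i)) ->
  (forall i, (w i <= E i + c)%nat) -> summable (fun i => q ^ E i).
Proof.
  intros Hq Hw HE. set (s := Rmax (Cmod q) (1 / 2)).
  assert (Hs1 : (s < 1)%R) by (apply Rmax_lub_lt; lra).
  assert (Hs0 : (1 / 2 <= s)%R) by apply Rmax_r.
  assert (Hqs : (Cmod q <= s)%R) by apply Rmax_l.
  assert (Hsc : (0 < s ^ c)%R) by (apply pow_lt; lra).
  apply summable_le with (fun i => RtoC (/ s ^ c) * RtoC s ^ w i).
  - intros i. rewrite Cmod_mult, !Cmod_pow, !Cmod_R, (Rabs_pos_eq s) by lra.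
    rewrite Rabs_pos_eq by (apply Rlt_le, Rinv_0_lt_compat; lra).
    apply Rle_trans with (s ^ E i)%R; [apply pow_incr; split; [apply Cmod_ge_0|easy]|].
    apply Rmult_le_reg_l with (s ^ c)%R; [easy|].
    rewrite <- Rmult_assoc, Rinv_r, Rmult_1_l by lra.
    rewrite <- pow_add, Nat.add_comm.
    replace (E i + c)%nat with (w i + (E i + c - w i))%nat by (specialize (HE i); lia).
    rewrite pow_add. rewrite <- (Rmult_1_r (s ^ w i)) at 2.
    apply Rmult_le_compat_l; [apply pow_le; lra|].
    rewrite <- (pow1 (E i + c - w i)). apply pow_incr. lra.
  - apply summable_scal, Hw. rewrite Cmod_R, Rabs_pos_eq; lra.
Qed.

Lemma sgnstar_nonneg k : (0 <= k)%Z -> sgnstar k = 1.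
Proof. intros H. unfold sgnstar. apply Z.leb_le in H. now rewrite H. Qed.

Lemma sgnstar_neg k : (k < 0)%Z -> sgnstar k = - (1).
Proof.
  intros H. unfold sgnstar. apply Z.leb_gt in H. rewrite H.
  unfold RtoC, Copp; simpl; f_equal; ring.
Qed.

Lemma sgnstar_reflect k : sgnstar (-1 - k) = - sgnstar k.
Proof.
  destruct (Z_le_gt_dec 0 k).
  - rewrite (sgnstar_nonneg k), sgnstar_neg by lia. ring.
  - rewrite (sgnstar_neg k), sgnstar_nonneg by lia. ring.
Qed.

Lemma Cmod_sgnstar k : Cmod (sgnstar k) = 1%R.
Proof.
  destruct (Z_le_gt_dec 0 k); [rewrite sgnstar_nonneg by lia|rewrite sgnstar_neg by lia;
    rewrite Cmod_opp]; apply Cmod_1.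
Qed.

Lemma csum_odd {I} (f : I -> C) (h : I -> I) : summable f ->
  (forall i, h (h i) = i) -> (forall i, f (h i) = - f i) -> csum f = 0.
Proof.
  intros Hf Hh Ho.
  assert (E : csum f = - csum f).
  { rewrite <- csum_opp by easy. rewrite <- (csum_bij h h f) by easy. now apply csum_ext. }
  assert (E2 : RtoC 2 * csum f = 0).
  { replace (RtoC 2 * csum f) with (csum f + csum f) by ring. rewrite E at 1. ring. }
  assert (H2 : RtoC 2 <> 0) by (intros H; apply RtoC_inj in H; lra).
  replace (csum f) with (/ RtoC 2 * (RtoC 2 * csum f)) by (field; easy).
  rewrite E2. ring.
Qed.

(** The slack 1 in the growth condition is for exponents such as k^2 + k, which vanishes at k =
    -1. *)
Lemma summable_sgn (q : C) (t E : Z -> Z) (h : Z -> C) (K : R) : (Cmod q < 1)%R ->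
  (forall k, (Z.abs k <= E k + 1)%Z) -> (forall k, (Cmod (h k) <= K)%R) ->
  summable (fun k => sgnstar (t k) * q ^ Z.to_nat (E k) * h k).
Proof.
  intros Hq HE HK.
  apply summable_le with (fun k => h k * q ^ Z.to_nat (E k)).
  - intros k. rewrite !Cmod_mult, Cmod_sgnstar. right. ring.
  - apply summable_bounded_mult with K; [easy|].
    apply summable_pow_ge with (w := Z.abs_nat) (c := 1%nat); [easy|now apply summable_geom_Z|].
    intros k. specialize (HE k). lia.
Qed.

Lemma summable_sgn_pow (q : C) (t E : Z -> Z) : (Cmod q < 1)%R ->
  (forall k, (Z.abs k <= E k + 1)%Z) -> summable (fun k => sgnstar (t k) * q ^ Z.to_nat (E k)).
Proof.
  intros Hq HE. apply summable_le with (fun k => sgnstar (t k) * q ^ Z.to_nat (E k) * 1).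
  - intros k. rewrite Cmult_1_r. apply Rle_refl.
  - apply (summable_sgn q t E (fun _ => 1) 1 Hq HE). intros k. rewrite Cmod_1. lra.
Qed.

(** * Signed theta sums and the recurrence for [Wq] *)

(** The reflection k -> -1-k fixes k^2 + k and reverses sgn*. *)
Lemma sgn_theta_eq0 (q : C) : (Cmod q < 1)%R ->
  csum (fun k => sgnstar k * q ^ Z.to_nat (k * k + k)) = 0.
Proof.
  intros Hq. apply csum_odd with (fun k => (-1 - k)%Z).
  - apply (summable_sgn_pow q (fun k => k) (fun k => k * k + k)%Z); [easy|intros; nia].
  - intros k. lia.
  - intros k. rewrite sgnstar_reflect.
    replace ((-1 - k) * (-1 - k) + (-1 - k))%Z with (k * k + k)%Z by ring. ring.
Qed.

Lemma sgn_theta_eq_opp1 (q : C) : (Cmod q < 1)%R ->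
  csum (fun k => sgnstar (k - 1) * q ^ Z.to_nat (k * k)) = - (1).
Proof.
  intros Hq.
  set (f := fun k => sgnstar (k - 1) * q ^ Z.to_nat (k * k)).
  (* The sign sgn*(k-1) is odd under k -> -k except at k = 0, where it is -1. Adding [d] makes the
     whole family odd, so the original sum is minus the sum of [d]. *)
  set (d := fun k : Z => if Z.eq_dec k 0 then RtoC 1 else RtoC 0).
  assert (Hd : has_sum d 1).
  { apply (has_sum_single d 0%Z). intros i Hi. unfold d. now destruct (Z.eq_dec i 0). }
  assert (Hf : summable f).
  { apply (summable_sgn_pow q (fun k => k - 1)%Z (fun k => k * k)%Z); [easy|intros; nia]. }
  assert (Hds : summable d).
  (* With 0^0 = 1, the geometric family of ratio 0 dominates a family supported at 0. *)
  { apply summable_le with (fun k => 0 ^ Z.abs_nat k);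
      [|apply summable_geom_Z; rewrite Cmod_0; lra].
    intros k. unfold d. destruct (Z.eq_dec k 0) as [->|Hk].
    - simpl. lra.
    - rewrite Cmod_0. apply Cmod_ge_0. }
  assert (Hodd : csum (fun k => f k + d k) = 0).
  { apply csum_odd with Z.opp; [now apply summable_plus|intros; lia|].
    intros k. unfold f, d. replace (- k * - k)%Z with (k * k)%Z by ring.
    destruct (Z.eq_dec k 0) as [->|Hk].
    - simpl. rewrite sgnstar_neg by lia. ring.
    - destruct (Z.eq_dec (- k) 0); [lia|].
      destruct (Z_le_gt_dec 0 k).
      + rewrite (sgnstar_neg (- k - 1)), sgnstar_nonneg by lia. ring.
      + rewrite (sgnstar_neg (k - 1)), sgnstar_nonneg by lia. ring. }
  rewrite csum_plus, (csum_unique d 1) in Hodd by easy.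
  replace (csum f) with (csum f + 1 - 1) by ring. rewrite Hodd. ring.
Qed.

(** At base q^2 and with -m for m, this is the sum over k in the overview's formula for a_m^2; by
    [Wq_opp] the sign of m does not matter. *)
Definition Wq (q : C) (m : Z) : C :=
  csum (fun k => sgnstar k * q ^ Z.to_nat (k * k + k) * Bq q (m + k)).

Lemma summable_Wq (q : C) m : (Cmod q < 1)%R ->
  summable (fun k => sgnstar k * q ^ Z.to_nat (k * k + k) * Bq q (m + k)).
Proof.
  intros Hq. destruct (Bq_bounded q Hq) as (K & _ & HK).
  apply (summable_sgn q (fun k => k) (fun k => k * k + k)%Z (fun k => Bq q (m + k)) K);
    [easy|intros; nia|auto].
Qed.

(** Under k -> -1-k the sign flips and B_(-m+k) becomes B_(-1-(m+k)), the complement of B_(m+k). The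
    constant in the complement relation contributes a multiple of [sgn_theta_eq0], that is 0. *)
Lemma Wq_opp (q : C) m : (Cmod q < 1)%R -> Wq q (- m) = Wq q m.
Proof.
  intros Hq. unfold Wq at 1.
  rewrite <- (csum_bij (fun k => (-1 - k)%Z) (fun k => (-1 - k)%Z))
    by (try (intros; lia); now apply summable_Wq).
  assert (Hs : summable (fun k => sgnstar k * q ^ Z.to_nat (k * k + k))).
  { apply (summable_sgn_pow q (fun k => k) (fun k => k * k + k)%Z); [easy|intros; nia]. }
  rewrite (csum_ext _ (fun k => (- (vq q * vq q)) * (sgnstar k * q ^ Z.to_nat (k * k + k)) +
     sgnstar k * q ^ Z.to_nat (k * k + k) * Bq q (m + k))).
  - rewrite csum_plus, csum_scal, sgn_theta_eq0 by
      (try apply summable_scal; try apply summable_Wq; easy). unfold Wq. ring.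
  - intros k. rewrite sgnstar_reflect, <- (Bq_complement q (m + k) Hq).
    replace ((-1 - k) * (-1 - k) + (-1 - k))%Z with (k * k + k)%Z by ring.
    replace (- m + (-1 - k))%Z with (-1 - (m + k))%Z by ring. ring.
Qed.

(** Two passes of complement followed by reflection. The first moves B_(m+k) to B_(m+k+1) and, after
    a shift of k, the weight k^2 + k to k^2; the second restores k^2 + k with m+1 in place of m. The
    sign then reads sgn*(k-1) instead of sgn*(k), and the term k = 0 accounts for the discrepancy -2
    [bq q (S n)]. *)
Lemma Wq_rec (q : C) (n : nat) : (Cmod q < 1)%R ->
  Wq q (Z.of_nat n) = q ^ n * (vq q * vq q + q ^ S n * Wq q (Z.of_nat (S n))
                               - 2 * q ^ S n * bq q (S n)).
Proof.
  intros Hq. set (m := Z.of_nat n). set (D := vq q * vq q).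
  destruct (Bq_bounded q Hq) as (K & _ & HK).
  set (f := fun k => sgnstar (k - 1) * q ^ Z.to_nat (k * k) * Bq q (m + k)).
  assert (Hf : summable f).
  { apply (summable_sgn q (fun k => k - 1)%Z (fun k => k * k)%Z (fun k => Bq q (m + k)) K);
      [easy|intros; nia|auto]. }
  assert (Hs0 : summable (fun k => sgnstar k * q ^ Z.to_nat (k * k + k))).
  { apply (summable_sgn_pow q (fun k => k) (fun k => k * k + k)%Z); [easy|intros; nia]. }
  assert (Hs1 : summable (fun k => sgnstar (k - 1) * q ^ Z.to_nat (k * k))).
  { apply (summable_sgn_pow q (fun k => k - 1)%Z (fun k => k * k)%Z); [easy|intros; nia]. }
  (* Reflection adds m + k + 1 to the exponent, which completes the square: k^2 + k + m + k + 1 =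
     (k+1)^2 + m. *)
  assert (E1 : Wq q m = - q ^ n * csum f).
  { unfold Wq.
    rewrite (csum_ext _ (fun k => D * (sgnstar k * q ^ Z.to_nat (k * k + k)) +
                                  (- q ^ n) * f (k + 1)%Z)).
    - rewrite csum_plus, !csum_scal, sgn_theta_eq0, (csum_bij (fun k => (k + 1)%Z) (fun k => (k - 1)%Z))
        by (try apply summable_scal; try (apply (summable_inj (fun k => (k + 1)%Z)); [intros; lia|]);
            try (intros; lia); easy).
      ring.
    - intros k. unfold f, D. rewrite <- (Bq_complement q (m + k) Hq).
      replace (k + 1 - 1)%Z with k by ring.
      generalize (Bq_opp q (k * k + k) (m + (k + 1)) ltac:(nia) ltac:(nia)).
      replace (- (m + (k + 1)))%Z with (-1 - (m + k))%Z by ring.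
      replace (Z.to_nat (k * k + k + (m + (k + 1)))) with (n + Z.to_nat ((k + 1) * (k + 1)))%nat by nia.
      rewrite Cpow_add_r. intros E.
      transitivity (sgnstar k * q ^ Z.to_nat (k * k + k) * Bq q (m + k)
        + sgnstar k * (q ^ Z.to_nat (k * k + k) * Bq q (-1 - (m + k)))
        - sgnstar k * (q ^ n * q ^ Z.to_nat ((k + 1) * (k + 1)) * Bq q (m + (k + 1)))).
      + rewrite E. ring.
      + ring. }
  (* Correction at k = 0, the only index where sgn*(k) and sgn*(k-1) differ. *)
  set (d := fun k : Z => if Z.eq_dec k 0 then - (2) * bq q (S n) else RtoC 0).
  assert (Hd : has_sum d (- (2) * bq q (S n))).
  { apply (has_sum_single d 0%Z). intros i Hi. unfold d. now destruct (Z.eq_dec i 0). }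
  assert (Hds : summable d).
  { apply summable_le with (fun k => - (2) * bq q (S n) * 0 ^ Z.abs_nat k);
      [|apply summable_scal, summable_geom_Z; rewrite Cmod_0; lra].
    intros k. unfold d. destruct (Z.eq_dec k 0) as [->|Hk].
    - simpl. rewrite Cmult_1_r. lra.
    - rewrite Cmod_0. apply Cmod_ge_0. }
  assert (E2 : csum f = - D + - q ^ S n * (Wq q (Z.of_nat (S n)) + - (2) * bq q (S n))).
  { rewrite (csum_ext f (fun k => D * (sgnstar (k - 1) * q ^ Z.to_nat (k * k)) +
        (- q ^ S n) * (sgnstar k * q ^ Z.to_nat (k * k + k) * Bq q (Z.of_nat (S n) + k) + d k))).
    - rewrite csum_plus, !csum_scal, csum_plus, sgn_theta_eq_opp1, (csum_unique d _ Hd)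
        by (repeat (apply summable_scal || apply summable_plus); auto using summable_Wq).
      unfold Wq. ring.
    - intros k.
      assert (Es : sgnstar k * q ^ Z.to_nat (k * k + k) * Bq q (Z.of_nat (S n) + k) + d k =
                   sgnstar (k - 1) * q ^ Z.to_nat (k * k + k) * Bq q (Z.of_nat (S n) + k)).
      { unfold d. destruct (Z.eq_dec k 0) as [->|Hk].
        - rewrite (Z.add_0_r (Z.of_nat (S n))), Bq_nat, sgnstar_nonneg, sgnstar_neg by lia. simpl. ring.
        - destruct (Z_le_gt_dec 0 k).
          + rewrite !sgnstar_nonneg by lia. ring.
          + rewrite !sgnstar_neg by lia. ring. }
      rewrite Es. unfold f, D. rewrite <- (Bq_complement q (m + k) Hq).
      generalize (Bq_opp q (k * k) (m + (k + 1)) ltac:(nia) ltac:(nia)).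
      replace (- (m + (k + 1)))%Z with (-1 - (m + k))%Z by ring.
      replace (m + (k + 1))%Z with (Z.of_nat (S n) + k)%Z by lia.
      replace (Z.to_nat (k * k + (Z.of_nat (S n) + k))) with (S n + Z.to_nat (k * k + k))%nat by nia.
      rewrite Cpow_add_r. intros E.
      transitivity (sgnstar (k - 1) * q ^ Z.to_nat (k * k) * Bq q (m + k)
        + sgnstar (k - 1) * (q ^ Z.to_nat (k * k) * Bq q (-1 - (m + k)))
        - sgnstar (k - 1) * (q ^ S n * q ^ Z.to_nat (k * k + k) * Bq q (Z.of_nat (S n) + k))).
      + rewrite E. ring.
      + ring. }
  rewrite E1, E2. ring.
Qed.

Lemma Wq_bounded (q : C) : (Cmod q < 1)%R -> exists K, forall m, (Cmod (Wq q m) <= K)%R.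
Proof.
  intros Hq. destruct (Bq_bounded q Hq) as (K & HK0 & HK).
  assert (Hs0 : summable (fun k => sgnstar k * q ^ Z.to_nat (k * k + k))).
  { apply (summable_sgn_pow q (fun k => k) (fun k => k * k + k)%Z); [easy|intros; nia]. }
  destruct (csum_mult_bounded _ Hs0) as [M HM]. exists (M * K)%R. intros m.
  apply (HM (fun k => Bq q (m + k))); auto.
Qed.

Lemma bq_square (q : C) (m : Z) : (Cmod q < 1)%R ->
  q ^ Z.abs_nat m * (bq q (Z.abs_nat m) * bq q (Z.abs_nat m)) = vq q * vq q * Wq q m.
Proof.
  intros Hq.
  assert (HW : Wq q m = Wq q (Z.of_nat (Z.abs_nat m))).
  { destruct (Z_le_gt_dec 0 m); [|rewrite <- Wq_opp by easy]; f_equal; lia. }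
  rewrite HW. generalize (Z.abs_nat m). clear m HW. intros n.
  set (x := fun n => q ^ n * (bq q n * bq q n) - vq q * vq q * Wq q (Z.of_nat n)).
  assert (Hx : x n = 0).
  { destruct (bq_bounded q Hq) as (K & HK0 & HK). destruct (Wq_bounded q Hq) as (M & HM).
    assert (HM0 : (0 <= M)%R) by (eapply Rle_trans; [apply Cmod_ge_0|apply (HM 0%Z)]).
    apply (bounded_expanding_eq0 x (Cmod q) (K * K + Cmod (vq q * vq q) * M)).
    - split; [apply Cmod_ge_0|easy].
    - intros k. unfold x. eapply Rle_trans; [apply Cmod_triangle|].
      apply Rplus_le_compat.
      + rewrite Cmod_mult, <- (Rmult_1_l (K * K)), Cmod_mult.
        apply Rmult_le_compat; [apply Cmod_ge_0|apply Rmult_le_pos; apply Cmod_ge_0|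
          now apply Cmod_pow_le1|]. apply Rmult_le_compat; auto; apply Cmod_ge_0.
      + rewrite Cmod_opp, Cmod_mult. apply Rmult_le_compat_l; [apply Cmod_ge_0|auto].
    - intros k.
      (* Writing vq^2 as b_k + q^(k+1) b_(k+1), the inhomogeneous part of [Wq_rec] cancels against
         the expansion of b_k^2. The term -2 q^(k+1) b_(k+1) there is exactly the cross term of the
         square. *)
      assert (E : x k = q ^ (k + k) * (q * x (S k))).
      { unfold x. rewrite (Wq_rec q k Hq), <- (bq_rec q k Hq), Cpow_add_r. simpl Cpow. ring. }
      rewrite E, !Cmod_mult. rewrite <- (Rmult_1_l (Cmod q * Cmod (x (S k)))) at 2.
      apply Rmult_le_compat_r; [apply Rmult_le_pos; apply Cmod_ge_0|now apply Cmod_pow_le1]. }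
  unfold x in Hx.
  replace (q ^ n * (bq q n * bq q n)) with
    (q ^ n * (bq q n * bq q n) - vq q * vq q * Wq q (Z.of_nat n) + vq q * vq q * Wq q (Z.of_nat n)) by ring.
  rewrite Hx. ring.
Qed.

(** * Convolution *)

(* [aq q m] is the coefficient of [z^m] in [1 / ((zq;q^2)_oo (q/z;q^2)_oo)]. *)
Definition aq (q : C) (m : Z) : C := q ^ Z.abs_nat m * bq (q * q) (Z.abs_nat m).

Lemma Cmod_sq_lt1 (q : C) : (Cmod q < 1)%R -> (Cmod (q * q) < 1)%R.
Proof. intros Hq. rewrite Cmod_mult. generalize (Cmod_ge_0 q). nra. Qed.

Lemma Cpow_sq (q : C) n : (q * q) ^ n = q ^ (2 * n).
Proof. rewrite Cpow_mult_l, <- Cpow_add_r. f_equal. lia. Qed.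

Lemma summable_aq (q : C) : (Cmod q < 1)%R -> summable (aq q).
Proof.
  intros Hq. destruct (bq_bounded (q * q) (Cmod_sq_lt1 q Hq)) as (K & _ & HK).
  apply summable_le with (fun m => bq (q * q) (Z.abs_nat m) * q ^ Z.abs_nat m).
  - intros m. unfold aq. rewrite Cmult_comm. lra.
  - apply summable_bounded_mult with K; [auto|now apply summable_geom_Z].
Qed.

Lemma aq_opp (q : C) m : aq q (- m) = aq q m.
Proof. unfold aq. now replace (Z.abs_nat (- m)) with (Z.abs_nat m) by lia. Qed.

(** * Euler's series and the value of sum_m a_m *)

(** Euler's expansion of 1/(x;Q)_oo; the lemmas below work with the series and its functional
    equation. *)
Definition euler_sum (Q x : C) : C := csum (fun i => x ^ i * uq Q i).

Lemma euler_sum_step (Q x : C) : (Cmod Q < 1)%R -> (Cmod x < 1)%R ->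
  euler_sum Q x * (1 - x) = euler_sum Q (x * Q).
Proof.
  intros HQ Hx. destruct (uq_bounded Q HQ) as (K & _ & HK).
  assert (HxQ : (Cmod (x * Q) < 1)%R).
  { rewrite Cmod_mult. generalize (Cmod_ge_0 x), (Cmod_ge_0 Q). nra. }
  assert (H1 : summable (fun i => x ^ i * uq Q i)) by now apply summable_geom_mult with K.
  assert (H2 : summable (fun i => (x * Q) ^ i * uq Q i)) by now apply summable_geom_mult with K.
  assert (E : euler_sum Q x + (- (1)) * euler_sum Q (x * Q) = x * euler_sum Q x).
  { unfold euler_sum. rewrite <- !csum_scal, <- csum_plus by (try apply summable_scal; easy).
    rewrite csum_nat_S by (apply summable_plus; try apply summable_scal; easy).
    cbv beta. simpl (_ ^ 0).
    rewrite (csum_ext _ (fun n => x * (x ^ n * uq Q n))).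
    - ring.
    - intros n. rewrite (uq_step Q n HQ), Cpow_mult_l. simpl Cpow. ring. }
  replace (euler_sum Q (x * Q)) with
    (euler_sum Q x - (euler_sum Q x + (- (1)) * euler_sum Q (x * Q))) by ring.
  rewrite E. ring.
Qed.

Lemma euler_sum_qpoch (Q x : C) N : (Cmod Q < 1)%R -> (Cmod x < 1)%R ->
  euler_sum Q x * qpoch x Q N = euler_sum Q (x * Q ^ N).
Proof.
  intros HQ Hx. induction N as [|N IH].
  - simpl. rewrite !Cmult_1_r. easy.
  - simpl. rewrite Cpown_pow, Cmult_assoc, IH, euler_sum_step; [f_equal; ring|easy|].
    rewrite Cmod_mult. generalize (Cmod_ge_0 x), (Cmod_ge_0 (Q ^ N)), (Cmod_pow_le1 Q N HQ). nra.
Qed.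

Lemma euler_sum_near0 (Q : C) : (Cmod Q < 1)%R -> exists K, forall x, (Cmod x <= 1 / 2)%R ->
  (Cmod (euler_sum Q x - 1) <= K * Cmod x)%R.
Proof.
  intros HQ. destruct (uq_bounded Q HQ) as (K & HK0 & HK). exists (2 * K)%R.
  intros x Hx. assert (Hx1 : (Cmod x < 1)%R) by lra.
  assert (Hs : summable (fun i => x ^ i * uq Q i)) by now apply summable_geom_mult with K.
  unfold euler_sum. rewrite csum_nat_S by easy. simpl (x ^ 0). rewrite uq_0.
  rewrite (csum_ext _ (fun n => x * (x ^ n * uq Q (S n)))) by (intros; simpl; ring).
  rewrite csum_scal by (apply summable_geom_mult with K; auto).
  replace (1 * 1 + x * csum (fun n => x ^ n * uq Q (S n)) - 1)
    with (x * csum (fun n => x ^ n * uq Q (S n))) by ring.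
  rewrite Cmod_mult, Rmult_comm. apply Rmult_le_compat_r; [apply Cmod_ge_0|].
  eapply Rle_trans; [apply Cmod_csum_geom_le with (K := K); auto|].
  unfold Rdiv. rewrite Rmult_comm. apply Rmult_le_compat_r; [easy|].
  (* For |x| <= 1/2 the geometric factor 1/(1 - |x|) is at most 2, hence the constant 2K. *)
  replace 2%R with (/ (1 / 2))%R by field. apply Rinv_le_contravar; lra.
Qed.

Lemma clim_pow_0 (q : C) : (Cmod q < 1)%R -> clim eventually (fun n => q ^ n) 0.
Proof.
  intros Hq. apply clim_eps; [typeclasses eauto|]. intros e He.
  destruct (pow_lt_1_zero (Cmod q) ltac:(rewrite Rabs_pos_eq; [easy|apply Cmod_ge_0]) e He) as [N HN].
  exists N. intros n Hn. replace (q ^ n - 0) with (q ^ n) by ring.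
  rewrite Cmod_pow. eapply Rle_lt_trans; [apply Rle_abs|]. now apply HN.
Qed.

Lemma euler_sum_continuous_0 (Q x : C) : (Cmod Q < 1)%R -> (Cmod x < 1)%R ->
  clim eventually (fun N => euler_sum Q (x * Q ^ N)) 1.
Proof.
  intros HQ Hx. destruct (euler_sum_near0 Q HQ) as [K HK].
  assert (Hl : clim eventually (fun N => x * Q ^ N) (x * 0)).
  { apply clim_mult; [typeclasses eauto|apply clim_const; typeclasses eauto|now apply clim_pow_0]. }
  rewrite Cmult_0_r in Hl. rewrite clim_eps in Hl by typeclasses eauto.
  apply clim_eps; [typeclasses eauto|]. intros e He.
  set (d := Rmin (1 / 2) (e / (Rabs K + 1))).
  assert (HK1 : (0 < Rabs K + 1)%R) by (generalize (Rabs_pos K); lra).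
  assert (Hd : (0 < d)%R) by (apply Rmin_glb_lt; [lra|apply Rdiv_lt_0_compat; lra]).
  destruct (Hl d Hd) as [N HN]. exists N. intros n Hn. specialize (HN n Hn). cbv beta in HN.
  replace (x * Q ^ n - 0) with (x * Q ^ n) in HN by ring.
  assert (d <= 1 / 2)%R by apply Rmin_l.
  assert (Hde : (d * (Rabs K + 1) <= e)%R).
  { apply Rle_trans with (e / (Rabs K + 1) * (Rabs K + 1))%R.
    - apply Rmult_le_compat_r; [lra|apply Rmin_r].
    - right. field. lra. }
  eapply Rle_lt_trans; [apply HK; lra|].
  generalize (Cmod_ge_0 (x * Q ^ n)), (Rle_abs K), (Rabs_pos K). nra.
Qed.

Lemma qpoch_split (q : C) N : qpoch q (q * q) N * qpoch (q * q) (q * q) N = qpoch q q (2 * N).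
Proof.
  induction N as [|N IH].
  - simpl. ring.
  - replace (2 * S N)%nat with (S (S (2 * N))) by lia. rewrite 3!qpoch_S, <- IH.
    cbn [qpoch]. rewrite Cpown_pow, !Cpow_sq.
    replace (2 * S N)%nat with (S (S (2 * N))) by lia. cbn [Cpow]. ring.
Qed.

(** This is 1/(q;q^2)_oo = (q^2;q^2)_oo/(q;q)_oo: by [qpoch_split] the quotient
    (q;q)_(2N)/(q^2;q^2)_N is (q;q^2)_N, which carries the series from argument q to q^(2N+1), where
    it tends to 1. *)
Lemma euler_sum_eval (q : C) : (Cmod q < 1)%R -> euler_sum (q * q) q * vq (q * q) = vq q.
Proof.
  intros Hq. assert (HQ := Cmod_sq_lt1 q Hq).
  assert (H1 : clim eventually (fun N => euler_sum (q * q) q * (qpoch q q (2 * N) * uq (q * q) N))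
     (euler_sum (q * q) q * (/ vq q * vq (q * q)))).
  { apply clim_mult; [typeclasses eauto|apply clim_const; typeclasses eauto|].
    apply clim_mult; [typeclasses eauto| |now apply uq_limit].
    generalize (qpoch_limit q Hq). change (is_qpoch_inf q q (/ vq q)) with (clim eventually (qpoch q q) (/ vq q)).
    rewrite !clim_eps by typeclasses eauto. intros H e He. destruct (H e He) as [N HN].
    exists N. intros n Hn. apply HN. lia. }
  assert (E : euler_sum (q * q) q * (/ vq q * vq (q * q)) = 1).
  { eapply clim_unique; [| exact H1|]; [typeclasses eauto|].
    eapply clim_ext; [typeclasses eauto| |apply (euler_sum_continuous_0 (q * q) q HQ Hq)].
    intros N. cbv beta. rewrite <- euler_sum_qpoch by easy. f_equal.
    rewrite <- qpoch_split. unfold uq. field. now apply qpoch_neq0. }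
  replace (euler_sum (q * q) q * vq (q * q)) with
    (vq q * (euler_sum (q * q) q * (/ vq q * vq (q * q)))) by (field; now apply vq_neq0).
  rewrite E. ring.
Qed.

(** Summing all coefficients means putting z = 1 in the generating product. The double series over
    (i, j) is sorted by the difference i - j = m. *)
Lemma csum_aq_euler (q : C) : (Cmod q < 1)%R ->
  csum (aq q) = euler_sum (q * q) q * euler_sum (q * q) q.
Proof.
  intros Hq. assert (HQ := Cmod_sq_lt1 q Hq).
  destruct (uq_bounded (q * q) HQ) as (K & _ & HK).
  assert (Hs : summable (fun i => q ^ i * uq (q * q) i)) by now apply summable_geom_mult with K.
  set (g := fun p : nat * nat => (q ^ fst p * uq (q * q) (fst p)) * (q ^ snd p * uq (q * q) (snd p))).
  assert (Hg : summable g) by now apply (summable_prod (fun i => q ^ i * uq (q * q) i)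
     (fun i => q ^ i * uq (q * q) i)).
  (* With n = min(i, j), the pair (i, j) is n plus the positive and negative parts of m. *)
  set (h := fun p : Z * nat => (snd p + Z.to_nat (fst p), snd p + Z.to_nat (- fst p))%nat).
  assert (Hhk : forall p, (Z.of_nat (fst (h p)) - Z.of_nat (snd (h p)), min (fst (h p)) (snd (h p)))%Z = p).
  { intros [m n]. unfold h. simpl. f_equal; lia. }
  assert (Hgh : summable (fun p => g (h p))).
  { apply summable_inj; [|easy]. intros x y E. now rewrite <- (Hhk x), <- (Hhk y), E. }
  assert (Ega : forall m n, g (h (m, n)) = q ^ Z.abs_nat m *
      ((q * q) ^ n * (uq (q * q) n * uq (q * q) (n + Z.abs_nat m)))).
  { intros m n. unfold g, h. simpl fst. simpl snd.
    transitivity (q ^ (n + Z.to_nat m) * q ^ (n + Z.to_nat (- m)) *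
       (uq (q * q) (n + Z.to_nat m) * uq (q * q) (n + Z.to_nat (- m)))); [ring|].
    rewrite (Cmult_assoc (q ^ Z.abs_nat m)), Cpow_sq, <- !Cpow_add_r. f_equal; [f_equal; lia|].
    destruct (Z_le_gt_dec 0 m).
    - replace (Z.to_nat (- m)) with O by lia. replace (Z.abs_nat m) with (Z.to_nat m) by lia.
      rewrite Nat.add_0_r. ring.
    - replace (Z.to_nat m) with O by lia. replace (Z.abs_nat m) with (Z.to_nat (- m)) by lia.
      rewrite Nat.add_0_r. ring. }
  transitivity (csum g); [|exact (csum_prod (fun i => q ^ i * uq (q * q) i)
     (fun i => q ^ i * uq (q * q) i) Hs Hs)].
  rewrite <- (csum_bij h (fun p => (Z.of_nat (fst p) - Z.of_nat (snd p), min (fst p) (snd p))%Z) g);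
    [|exact Hhk| |easy].
  - rewrite <- csum_fubini by easy. apply csum_ext. intros m. unfold aq, bq.
    rewrite <- csum_scal by now apply summable_bq. apply csum_ext. intros n. symmetry. apply Ega.
  - intros [i j]. unfold h. simpl. f_equal; lia.
Qed.

Lemma csum_aq (q : C) : (Cmod q < 1)%R ->
  vq (q * q) * vq (q * q) * csum (aq q) = vq q * vq q.
Proof.
  intros Hq. rewrite csum_aq_euler, <- (euler_sum_eval q Hq) by easy. ring.
Qed.

Lemma summable_conv (q : C) k : (Cmod q < 1)%R -> summable (fun m => aq q m * Bq (q * q) (k - m)).
Proof.
  intros Hq. destruct (Bq_bounded (q * q) (Cmod_sq_lt1 q Hq)) as (K & _ & HK).
  apply summable_le with (fun m => Bq (q * q) (k - m) * aq q m).
  - intros m. rewrite Cmult_comm. lra.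
  - apply summable_bounded_mult with K; [auto|now apply summable_aq].
Qed.

(** As a_m is even, m -> -m in the second sum pairs B_(k-m) with its complement; the resulting
    constant is evaluated by [csum_aq]. *)
Lemma conv_complement (q : C) k : (Cmod q < 1)%R ->
  csum (fun m => aq q m * Bq (q * q) (k - m)) + csum (fun m => aq q m * Bq (q * q) (-1 - k - m))
  = vq q * vq q.
Proof.
  intros Hq.
  rewrite <- (csum_bij Z.opp Z.opp (fun m => aq q m * Bq (q * q) (-1 - k - m)))
    by (try (intros; lia); now apply summable_conv).
  rewrite <- csum_plus; [|now apply summable_conv|
    apply (summable_inj Z.opp (fun m => aq q m * Bq (q * q) (-1 - k - m))); [intros; lia|now apply summable_conv]].
  rewrite <- (csum_aq q Hq), <- csum_scal by now apply summable_aq.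
  apply csum_ext. intros m. rewrite aq_opp, <- (Bq_complement (q * q) (k - m) (Cmod_sq_lt1 q Hq)).
  replace (-1 - k - - m)%Z with (-1 - (k - m))%Z by ring. ring.
Qed.

(** The shift of m by n exchanges the roles of |m| and |m+n|, so the same two [bq] factors appear on
    both sides. The powers of q agree since twice the positive part of x is x + |x|. *)
Lemma conv_opp (q : C) (n : nat) : (Cmod q < 1)%R ->
  csum (fun m => aq q m * Bq (q * q) (- Z.of_nat n - m))
  = q ^ n * csum (fun m => aq q m * Bq (q * q) (Z.of_nat n - m)).
Proof.
  intros Hq.
  rewrite <- (csum_bij (fun m => m + Z.of_nat n)%Z (fun m => m - Z.of_nat n)%Z
     (fun m => aq q m * Bq (q * q) (Z.of_nat n - m)))
    by (try (intros; lia); now apply summable_conv).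
  rewrite <- csum_scal by (apply (summable_inj (fun m => m + Z.of_nat n)%Z
     (fun m => aq q m * Bq (q * q) (Z.of_nat n - m))); [intros; lia|now apply summable_conv]).
  apply csum_ext. intros m. unfold aq, Bq. rewrite !Cpow_sq.
  replace (Z.abs_nat (- Z.of_nat n - m)) with (Z.abs_nat (m + Z.of_nat n)) by lia.
  replace (Z.abs_nat (Z.of_nat n - (m + Z.of_nat n))) with (Z.abs_nat m) by lia.
  assert (E : q ^ Z.abs_nat m * q ^ (2 * Z.to_nat (- (- Z.of_nat n - m))) =
     q ^ n * q ^ Z.abs_nat (m + Z.of_nat n) * q ^ (2 * Z.to_nat (- (Z.of_nat n - (m + Z.of_nat n))))).
  { rewrite <- !Cpow_add_r. f_equal. lia. }
  set (b1 := bq (q * q) (Z.abs_nat m)). set (b2 := bq (q * q) (Z.abs_nat (m + Z.of_nat n))).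
  transitivity (q ^ Z.abs_nat m * q ^ (2 * Z.to_nat (- (- Z.of_nat n - m))) * (b1 * b2)); [ring|].
  rewrite E. ring.
Qed.

Lemma conv_eq (q : C) k : (Cmod q < 1)%R ->
  csum (fun m => aq q m * Bq (q * q) (k - m)) = Bq q k.
Proof.
  intros Hq. set (y := fun k => csum (fun m => aq q m * Bq (q * q) (k - m))).
  set (x := fun n => y (Z.of_nat n) - bq q n).
  assert (Hx : forall n, x n = 0).
  { destruct (bq_bounded q Hq) as (K & HK0 & HK).
    destruct (Bq_bounded (q * q) (Cmod_sq_lt1 q Hq)) as (K' & HK0' & HK').
    destruct (csum_mult_bounded _ (summable_aq q Hq)) as (M & HM).
    apply (bounded_expanding_eq0 x (Cmod q) (M * K' + K)).
    - split; [apply Cmod_ge_0|easy].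
    - intros n. unfold x. eapply Rle_trans; [apply Cmod_triangle|]. rewrite Cmod_opp.
      apply Rplus_le_compat; [|auto]. apply HM; auto.
    - intros n.
      (* The convolution and B(q) obey the same complement and reflection relations, so the constant
         cancels in their difference. *)
      assert (E : x n = q ^ n * (- q * x (S n))).
      { assert (E1 := conv_complement q (Z.of_nat n) Hq).
        replace (-1 - Z.of_nat n)%Z with (- Z.of_nat (S n))%Z in E1 by lia.
        rewrite (conv_opp q (S n) Hq) in E1.
        assert (E2 := bq_rec q n Hq). rewrite <- E1 in E2.
        unfold x. replace (bq q n) with (bq q n + q ^ S n * bq q (S n) - q ^ S n * bq q (S n)) by ring.
        rewrite E2. unfold y. simpl Cpow. ring. }
      rewrite E, !Cmod_mult, Cmod_opp. rewrite <- (Rmult_1_l (Cmod q * Cmod (x (S n)))) at 2.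
      apply Rmult_le_compat_r; [apply Rmult_le_pos; apply Cmod_ge_0|now apply Cmod_pow_le1]. }
  assert (Hy : forall n, y (Z.of_nat n) = bq q n).
  { intros n. specialize (Hx n). unfold x in Hx.
    replace (y (Z.of_nat n)) with (y (Z.of_nat n) - bq q n + bq q n) by ring. rewrite Hx. ring. }
  change (y k = Bq q k). destruct (Z_le_gt_dec 0 k) as [Hk|Hk].
  - rewrite <- (Z2Nat.id k Hk). now rewrite Hy, Bq_nat.
  - replace k with (- Z.of_nat (Z.to_nat (- k)))%Z by lia.
    rewrite Bq_nat_opp, <- Hy. apply conv_opp. easy.
Qed.

(** * The two sides of the identity *)

Definition lhs_exp (n : nat) (k : Z) : Z :=
  (Z.of_nat n * (Z.of_nat n + 1) / 2 + Z.of_nat n * k + 2 * k * k + 2 * k)%Z.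

Lemma triangular_double (n : nat) :
  (2 * (Z.of_nat n * (Z.of_nat n + 1) / 2) = Z.of_nat n * (Z.of_nat n + 1))%Z.
Proof.
  symmetry. apply Z_div_exact_2; [lia|].
  destruct (Z.Even_or_Odd (Z.of_nat n)) as [[c ->]|[c ->]].
  - replace (2 * c * (2 * c + 1))%Z with (c * (2 * c + 1) * 2)%Z by ring. apply Z_mod_mult.
  - replace ((2 * c + 1) * (2 * c + 1 + 1))%Z with ((2 * c + 1) * (c + 1) * 2)%Z by ring.
    apply Z_mod_mult.
Qed.

Lemma lhs_exp_S n k : lhs_exp (S n) k = (lhs_exp n k + (k + Z.of_nat (S n)))%Z.
Proof.
  unfold lhs_exp. generalize (triangular_double n), (triangular_double (S n)). nia.
Qed.

(** Twice the exponent is (n+k)(n+k+1) + 3k(k+1). The linear lower bound lets a product of geometric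
    families dominate the double series. *)
Lemma lhs_exp_ge n k : (Z.of_nat n + Z.abs k <= lhs_exp n k + 3)%Z.
Proof.
  unfold lhs_exp. generalize (triangular_double n).
  assert (H1 : forall a : Z, (0 <= a * a - a)%Z) by (intros; nia).
  (* This quadratic is what remains for negative k; 12 times it equals (6k+7)^2 + 23. *)
  assert (H2 : (0 <= 3 * (k * k) + 7 * k + 6)%Z) by (generalize (Z.square_nonneg (6 * k + 7)); nia).
  specialize (H1 (Z.of_nat n + k)%Z). destruct (Z_le_gt_dec 0 k); nia.
Qed.

(** Keeps [Cpowz] in its natural-power branch, so no inverse of q enters. *)
Lemma lhs_exp_nonneg n k : (0 <= lhs_exp n k)%Z.
Proof.
  unfold lhs_exp. generalize (triangular_double n).
  assert (H1 : forall a : Z, (0 <= a * a + a)%Z) by (intros; nia).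
  generalize (H1 (Z.of_nat n + k)%Z), (H1 k). nia.
Qed.

Lemma Cmod_Cpown_opp1 n : Cmod (Cpown (-1) n) = 1%R.
Proof.
  rewrite Cpown_pow, Cmod_pow. replace (Cmod (-1)) with 1%R; [apply pow1|].
  rewrite Cmod_R, Rabs_left by lra. ring.
Qed.

Lemma lhs_term_eq (q : C) n k :
  lhs_term q n k = sgnstar k * (Cpown (-1) n * q ^ Z.to_nat (lhs_exp n k)).
Proof.
  unfold lhs_term. fold (lhs_exp n k). unfold Cpowz.
  generalize (lhs_exp_nonneg n k). intros H. apply Z.leb_le in H. rewrite H, (Cpown_pow q). ring.
Qed.

Lemma summable_lhs_pow (q : C) : (Cmod q < 1)%R ->
  summable (fun p : nat * Z => q ^ Z.to_nat (lhs_exp (fst p) (snd p))).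
Proof.
  intros Hq. apply summable_pow_ge with (w := fun p : nat * Z => (fst p + Z.abs_nat (snd p))%nat)
    (c := 3%nat); [easy| |].
  - intros s Hs. apply summable_le with (fun p : nat * Z => s ^ fst p * s ^ Z.abs_nat (snd p)).
    + intros p. rewrite Cpow_add_r. apply Rle_refl.
    + apply (summable_prod (fun n => s ^ n) (fun k => s ^ Z.abs_nat k));
        [now apply summable_geom|now apply summable_geom_Z].
  - intros [n k]. simpl. generalize (lhs_exp_ge n k). lia.
Qed.

Lemma summable_lhs_term (q : C) : (Cmod q < 1)%R ->
  summable (fun p : nat * Z => lhs_term q (fst p) (snd p)).
Proof.
  intros Hq. eapply summable_le; [|exact (summable_lhs_pow q Hq)].
  intros [n k]. simpl. rewrite lhs_term_eq, !Cmod_mult, Cmod_sgnstar, Cmod_Cpown_opp1. lra.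
Qed.

Lemma summable_lhs_inner (q : C) k : (Cmod q < 1)%R ->
  summable (fun n => Cpown (-1) n * q ^ Z.to_nat (lhs_exp n k)).
Proof.
  intros Hq. apply summable_bounded_mult with 1%R.
  - intros n. rewrite Cmod_Cpown_opp1. lra.
  - apply (summable_inj (fun n => (n, k))
      (fun p : nat * Z => q ^ Z.to_nat (lhs_exp (fst p) (snd p))));
      [intros x y E; now inversion E|now apply summable_lhs_pow].
Qed.

(** N rounds of complement and reflection. Since the exponent grows by k + N + 1 from N to N+1, each
    round emits one term of the series and leaves a remainder of the same shape. The factor
    q^(2(k^2+k)) is needed because n(n+1)/2 + nk alone may be negative. *)
Lemma Bq_iterate (q : C) k N : (Cmod q < 1)%R ->
  vq q * vq q * lsum (fun n => Cpown (-1) n * q ^ Z.to_nat (lhs_exp n k)) (seq 0 N) +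
  Cpown (-1) N * (q ^ Z.to_nat (lhs_exp N k) * Bq q (k + Z.of_nat N)) =
  q ^ Z.to_nat (2 * (k * k + k)) * Bq q k.
Proof.
  intros Hq. induction N as [|N IH].
  - simpl lsum. simpl Cpown. rewrite Z.add_0_r. unfold lhs_exp. simpl (Z.of_nat 0).
    replace (0 * (0 + 1) / 2 + 0 * k + 2 * k * k + 2 * k)%Z with (2 * (k * k + k))%Z
      by (change (0 * (0 + 1) / 2)%Z with 0%Z; ring). ring.
  - rewrite <- IH, seq_S, lsum_app. simpl lsum. simpl (0 + N)%nat.
    rewrite <- (Bq_complement q (k + Z.of_nat N) Hq).
    assert (E := Bq_opp q (lhs_exp N k) (k + Z.of_nat (S N)) (lhs_exp_nonneg N k)).
    rewrite <- lhs_exp_S in E. specialize (E (lhs_exp_nonneg _ _)).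
    rewrite <- E. replace (- (k + Z.of_nat (S N)))%Z with (-1 - (k + Z.of_nat N))%Z by lia.
    cbn [Cpown]. replace (RtoC (-1)) with (- (1)) by (unfold RtoC, Copp; simpl; f_equal; ring).
    ring.
Qed.

Lemma Bq_partial_theta (q : C) k : (Cmod q < 1)%R ->
  q ^ Z.to_nat (2 * (k * k + k)) * Bq q k =
  vq q * vq q * csum (fun n => Cpown (-1) n * q ^ Z.to_nat (lhs_exp n k)).
Proof.
  intros Hq. destruct (Bq_bounded q Hq) as (K & HK0 & HK).
  assert (Hs := summable_lhs_inner q k Hq). apply csum_correct, has_sum_seq in Hs.
  set (f := fun n => Cpown (-1) n * q ^ Z.to_nat (lhs_exp n k)) in *.
  set (r := fun N => Cpown (-1) (S N) * (q ^ Z.to_nat (lhs_exp (S N) k) * Bq q (k + Z.of_nat (S N)))).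
  assert (Hr : clim eventually r 0).
  { apply clim_eps; [typeclasses eauto|]. intros e He.
    assert (He' : (0 < e / (K + 1))%R) by (apply Rdiv_lt_0_compat; lra).
    destruct (pow_lt_1_zero (Cmod q) ltac:(rewrite Rabs_pos_eq; [easy|apply Cmod_ge_0]) _ He') as [N HN].
    (* The 3 offsets the additive constant of [lhs_exp_ge]. *)
    exists (N + 3)%nat. intros n Hn. replace (r n - 0) with (r n) by ring. unfold r.
    rewrite !Cmod_mult, Cmod_Cpown_opp1, Rmult_1_l, Cmod_pow.
    specialize (HN (Z.to_nat (lhs_exp (S n) k))).
    assert (HN' : (Cmod q ^ Z.to_nat (lhs_exp (S n) k) < e / (K + 1))%R).
    { eapply Rle_lt_trans; [apply Rle_abs|]. apply HN.
      generalize (lhs_exp_ge (S n) k). lia. }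
    assert (Hp : (0 <= Cmod q ^ Z.to_nat (lhs_exp (S n) k))%R) by (apply pow_le, Cmod_ge_0).
    specialize (HK (k + Z.of_nat (S n))%Z).
    apply Rle_lt_trans with (Cmod q ^ Z.to_nat (lhs_exp (S n) k) * (K + 1))%R.
    - apply Rmult_le_compat_l; [easy|lra].
    - apply Rmult_lt_reg_r with (/ (K + 1))%R; [apply Rinv_0_lt_compat; lra|].
      rewrite Rmult_assoc, Rinv_r, Rmult_1_r by lra. exact HN'. }
  apply clim_unique with (F := eventually) (f := fun _ : nat => q ^ Z.to_nat (2 * (k * k + k)) * Bq q k).
  - typeclasses eauto.
  - apply clim_const. typeclasses eauto.
  - replace (vq q * vq q * csum f) with (vq q * vq q * csum f + 0) by ring.
    eapply clim_ext; [typeclasses eauto| |apply clim_plus; [typeclasses eauto| |exact Hr]].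
    + intros n. apply (Bq_iterate q k (S n) Hq).
    + apply clim_mult; [typeclasses eauto|apply clim_const; typeclasses eauto|exact Hs].
Qed.

(** For fixed n4 = m the summand is a product of three such factors, each taking one third of
    q^(3|m|); summed over n, a factor gives a_m. *)
Definition rhs_factor (q : C) (m : Z) (n : nat) : C :=
  q ^ Z.abs_nat m * ((q * q) ^ n * (uq (q * q) n * uq (q * q) (n + Z.abs_nat m))).

Lemma rhs_term_factor (q : C) n1 n2 n3 m : (Cmod q < 1)%R ->
  rhs_term q n1 n2 n3 m = rhs_factor q m n1 * (rhs_factor q m n2 * rhs_factor q m n3).
Proof.
  intros Hq. unfold rhs_term, rhs_factor, uq. cbv zeta. rewrite Cpown_pow, !Cpow_sq.
  replace (2 * n1 + 2 * n2 + 2 * n3 + 3 * Z.abs_nat m)%nat with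
   (Z.abs_nat m + (Z.abs_nat m + (Z.abs_nat m + (2 * n1 + (2 * n2 + 2 * n3)))))%nat by lia.
  rewrite !(Cpow_add_r q). field.
  repeat split; apply qpoch_neq0; now apply Cmod_sq_lt1.
Qed.

Lemma summable_rhs_term (q : C) : (Cmod q < 1)%R ->
  summable (fun p : nat * (nat * (nat * Z)) =>
    rhs_term q (fst p) (fst (snd p)) (fst (snd (snd p))) (snd (snd (snd p)))).
Proof.
  intros Hq. assert (HQ := Cmod_sq_lt1 q Hq).
  destruct (uq_prod_bounded (q * q) HQ) as (K & HK).
  apply summable_le with (fun p : nat * (nat * (nat * Z)) =>
    RtoC (K * (K * K)) * ((q * q) ^ fst p * ((q * q) ^ fst (snd p) * ((q * q) ^ fst (snd (snd p)) *
       q ^ Z.abs_nat (snd (snd (snd p))))))).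
  - intros (n1 & n2 & n3 & m). simpl fst. simpl snd. rewrite rhs_term_factor by easy.
    unfold rhs_factor.
    assert (HK0 : (0 <= K)%R) by (eapply Rle_trans; [apply Cmod_ge_0|apply (HK O O)]).
    rewrite (Cmod_mult (RtoC _)), Cmod_R, Rabs_pos_eq by (repeat apply Rmult_le_pos; easy).
    set (u1 := uq (q * q) n1 * _). set (u2 := uq (q * q) n2 * _). set (u3 := uq (q * q) n3 * _).
    set (z := q ^ Z.abs_nat m).
    set (M := (q * q) ^ n1 * ((q * q) ^ n2 * ((q * q) ^ n3 * z))).
    transitivity (Cmod (u1 * (u2 * u3)) * Cmod M)%R.
    + rewrite <- Cmod_mult.
      (* Of the three factors q^|m|, one secures convergence in m; the other two are bounded by
         1. *)
      replace (z * ((q * q) ^ n1 * u1) * (z * ((q * q) ^ n2 * u2) * (z * ((q * q) ^ n3 * u3))))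
        with (z * z * ((u1 * (u2 * u3)) * M)) by (unfold M; ring).
      rewrite Cmod_mult. rewrite <- (Rmult_1_l (Cmod (_ * M))) at 2.
      apply Rmult_le_compat_r; [apply Cmod_ge_0|].
      rewrite Cmod_mult. generalize (Cmod_pow_le1 q (Z.abs_nat m) Hq). fold z.
      generalize (Cmod_ge_0 z). nra.
    + apply Rmult_le_compat_r; [apply Cmod_ge_0|]. rewrite !Cmod_mult.
      unfold u1, u2, u3.
      repeat apply Rmult_le_compat; try apply Rmult_le_pos; try apply Cmod_ge_0; apply HK.
  - apply summable_scal.
    apply (summable_prod (fun n => (q * q) ^ n) (fun p : nat * (nat * Z) =>
       (q * q) ^ fst p * ((q * q) ^ fst (snd p) * q ^ Z.abs_nat (snd (snd p)))));
      [now apply summable_geom|].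
    apply (summable_prod (fun n => (q * q) ^ n) (fun p : nat * Z =>
       (q * q) ^ fst p * q ^ Z.abs_nat (snd p))); [now apply summable_geom|].
    apply (summable_prod (fun n => (q * q) ^ n) (fun m => q ^ Z.abs_nat m));
      [now apply summable_geom|now apply summable_geom_Z].
Qed.

Lemma rhs_sum_cubes (q : C) : (Cmod q < 1)%R ->
  csum (fun p : nat * (nat * (nat * Z)) =>
    rhs_term q (fst p) (fst (snd p)) (fst (snd (snd p))) (snd (snd (snd p)))) =
  csum (fun m => aq q m * (aq q m * aq q m)).
Proof.
  intros Hq. assert (HQ := Cmod_sq_lt1 q Hq). assert (Hs := summable_rhs_term q Hq).
  set (h := fun p : Z * (nat * (nat * nat)) =>
    (fst (snd p), (fst (snd (snd p)), (snd (snd (snd p)), fst p)))).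
  rewrite <- (csum_bij h (fun p => (snd (snd (snd p)), (fst p, (fst (snd p), fst (snd (snd p)))))));
    [|now intros (? & ? & ? & ?)|now intros (? & ? & ? & ?)|exact Hs].
  rewrite <- csum_fubini.
  2:{ refine (summable_inj h _ _ Hs). intros (? & ? & ? & ?) (? & ? & ? & ?) E.
      unfold h in E. simpl in E. now inversion E. }
  apply csum_ext. intros m.
  assert (Hf : summable (rhs_factor q m)) by now apply summable_scal, summable_bq.
  assert (Ea : aq q m = csum (rhs_factor q m)).
  { unfold aq, bq. now rewrite <- csum_scal by now apply summable_bq. }
  rewrite Ea, <- (csum_prod (rhs_factor q m) (rhs_factor q m)) by easy.
  rewrite <- (csum_prod (rhs_factor q m) (fun p => rhs_factor q m (fst p) * rhs_factor q m (snd p)))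
    by (try apply summable_prod; easy).
  apply csum_ext. intros (n1 & n2 & n3). unfold h. simpl fst. simpl snd. now apply rhs_term_factor.
Qed.

Lemma aq_square (q : C) m : (Cmod q < 1)%R ->
  aq q m * aq q m = vq (q * q) * vq (q * q) *
    csum (fun k => sgnstar k * (q * q) ^ Z.to_nat (k * k + k) * Bq (q * q) (k - m)).
Proof.
  intros Hq. assert (HQ := Cmod_sq_lt1 q Hq).
  rewrite (csum_ext _ (fun k => sgnstar k * (q * q) ^ Z.to_nat (k * k + k) * Bq (q * q) (- m + k)))
    by (intros k; now replace (k - m)%Z with (- m + k)%Z by ring).
  fold (Wq (q * q) (- m)). rewrite Wq_opp, <- bq_square by easy.
  unfold aq. rewrite Cpow_mult_l. ring.
Qed.

Lemma cubes_eq_lhs (q : C) : (Cmod q < 1)%R ->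
  csum (fun m => aq q m * (aq q m * aq q m)) =
  vq q * vq q * (vq (q * q) * vq (q * q)) * csum (fun p : nat * Z => lhs_term q (fst p) (snd p)).
Proof.
  intros Hq. assert (HQ := Cmod_sq_lt1 q Hq).
  destruct (Bq_bounded (q * q) HQ) as (K & _ & HK).
  set (s := fun k => sgnstar k * (q * q) ^ Z.to_nat (k * k + k)).
  assert (Hs : summable s)
    by (apply (summable_sgn_pow (q * q) (fun k => k) (fun k => k * k + k)%Z); [easy|intros; nia]).
  (* Boundedness of B reduces this to the product family a_m s(k), which permits summing over m
     before k. *)
  assert (Hd : summable (fun p : Z * Z => aq q (fst p) * (s (snd p) * Bq (q * q) (snd p - fst p)))).
  { apply summable_le with (fun p : Z * Z => Bq (q * q) (snd p - fst p) * (aq q (fst p) * s (snd p))).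
    - intros p. right. f_equal. ring.
    - apply summable_bounded_mult with K; [auto|].
      apply (summable_prod (aq q) s); [now apply summable_aq|easy]. }
  assert (Hw : forall m, summable (fun k => s k * Bq (q * q) (k - m))).
  { intros m. apply (summable_sgn (q * q) (fun k => k) (fun k => k * k + k)%Z
      (fun k => Bq (q * q) (k - m)) K); [easy|intros; nia|auto]. }
  set (D := vq (q * q) * vq (q * q)).
  rewrite (csum_ext _ (fun m => csum (fun k => D * (aq q m * (s k * Bq (q * q) (k - m)))))).
  2:{ intros m. rewrite aq_square by easy. rewrite !csum_scal by (try apply summable_scal; apply Hw).
      unfold s, D. ring. }
  apply (summable_scal D) in Hd.
  set (f := fun p : Z * Z => D * (aq q (fst p) * (s (snd p) * Bq (q * q) (snd p - fst p)))) in *.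
  change (csum (fun m => csum (fun k => f (m, k))) =
    vq q * vq q * D * csum (fun p : nat * Z => lhs_term q (fst p) (snd p))).
  rewrite csum_fubini, <- (csum_bij (fun p : Z * Z => (snd p, fst p)) (fun p => (snd p, fst p)) f)
    by (try (now intros []); easy).
  rewrite <- (csum_bij (fun p : Z * nat => (snd p, fst p)) (fun p => (snd p, fst p)))
    by (try (now intros []); now apply summable_lhs_term).
  (* Both double sums are sliced with k outermost and compared slice by slice: the sum over m is
     [conv_eq], the sum over n1 is [Bq_partial_theta]. *)
  symmetry. apply has_sum_unique with (fun k => vq q * vq q * D * csum (fun n => lhs_term q n k)).
  - apply has_sum_scal. exact (has_sum_csum_slices _ (summable_swap _ (summable_lhs_term q Hq))).
  - eapply has_sum_ext; [|exact (has_sum_csum_slices _ (summable_swap _ Hd))].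
    intros k. unfold f. simpl fst. simpl snd.
    rewrite (csum_ext _ (fun m => D * s k * (aq q m * Bq (q * q) (k - m)))) by (intros; ring).
    rewrite csum_scal, conv_eq by (try apply summable_conv; easy).
    rewrite (csum_ext (fun n => lhs_term q n k)
      (fun n => sgnstar k * (Cpown (-1) n * q ^ Z.to_nat (lhs_exp n k))))
      by (intros; apply lhs_term_eq).
    rewrite csum_scal by now apply summable_lhs_inner.
    transitivity (D * sgnstar k * (q ^ Z.to_nat (2 * (k * k + k)) * Bq q k)).
    + unfold s. rewrite Cpow_sq. replace (2 * Z.to_nat (k * k + k))%nat with
        (Z.to_nat (2 * (k * k + k))) by nia. ring.
    + rewrite Bq_partial_theta by easy. ring.
Qed.

Theorem theorem1p2 (q : C) (hq : (Cmod q < 1)%R) :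
  exists P1 P2 L R : C,
    is_qpoch_inf q q P1 /\
    is_qpoch_inf (q * q) (q * q) P2 /\
    is_lhs_sum q L /\
    is_rhs_sum q R /\
    Cinv (P1 * P1) * Cinv (P2 * P2) * L = R.
Proof.
  assert (hQ := Cmod_sq_lt1 q hq).
  assert (HL := summable_lhs_term q hq). assert (HR := summable_rhs_term q hq).
  set (rt := fun p : nat * (nat * (nat * Z)) =>
    rhs_term q (fst p) (fst (snd p)) (fst (snd (snd p))) (snd (snd (snd p)))) in *.
  exists (/ vq q), (/ vq (q * q)), (csum (fun p : nat * Z => lhs_term q (fst p) (snd p))), (csum rt).
  split; [now apply qpoch_limit|]. split; [now apply qpoch_limit|]. split; [|split].
  (* The iterated sums on each side are successive slices of a single absolutely summable family, so
     every intermediate sum exists and the last one is the total. *)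
  - exists (fun n => csum (lhs_term q n)). split.
    + intros n. apply has_sum_is_Zseries. exact (summable_slice _ n HL).
    + apply has_sum_is_Cseries. exact (has_sum_csum_slices _ HL).
  - exists (fun n1 n2 n3 => csum (fun m => rt (n1, (n2, (n3, m))))),
      (fun n1 n2 => csum (fun p => rt (n1, (n2, p)))), (fun n1 => csum (fun p => rt (n1, p))).
    repeat split.
    + intros n1 n2 n3. apply (has_sum_is_Zseries (fun m => rt (n1, (n2, (n3, m))))).
      apply (summable_slice (fun p => rt (n1, (n2, p)))).
      apply (summable_slice (fun p => rt (n1, p))). now apply summable_slice.
    + intros n1 n2. apply has_sum_is_Cseries, (has_sum_csum_slices (fun p => rt (n1, (n2, p)))).
      apply (summable_slice (fun p => rt (n1, p))). now apply summable_slice.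
    + intros n1. apply has_sum_is_Cseries, (has_sum_csum_slices (fun p => rt (n1, p))).
      now apply summable_slice.
    + now apply has_sum_is_Cseries, has_sum_csum_slices.
  - unfold rt. rewrite rhs_sum_cubes, cubes_eq_lhs by easy.
    field. split; now apply vq_neq0.
Qed.
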